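(* Let $\kappa=\aleph_0$ or let $\kappa$ be a strongly compact cardinal. Let $\mathcal{C}$ be a small $(\kappa,\kappa)$-coherent category with $\kappa$-small disjoint coproducts and let $F:\mathcal{C}\to\mathbf{Set}$ be a $\kappa$-regular functor. Then there is a (set-indexed) family of $(\kappa,\kappa)$-coherent functors $M_i:\mathcal{C}\to\mathbf{Set}$ for which an elementary natural transformation $F\Rightarrow\prod_iM_i$ exists.
   Context: $\kappa$-small means of size $<\kappa$. A functor is $\kappa$-regular if it preserves $\kappa$-small limits and effective epimorphisms. A category is $(\kappa,\kappa)$-coherent if it has $\kappa$-small limits, pullback-stable effective epi-mono factorizations and pullback-stable $\kappa$-small unions, and: given a rooted cotree (opposite of a rooted tree) in which the predecessors of every vertex form an extremal epimorphic family of size $<\kappa$ and every branch is continuous (limits at limit steps) of length $<\kappa$, the limits (transfinite cocompositions) of the branches form an extremal epimorphic family on the root. A functor is $(\kappa,\kappa)$-coherent if it preserves $\kappa$-small limits, effective epis and $\kappa$-small unions. A natural transformation $\alpha:F\Rightarrow G$ between finite-limit-preserving functors is elementary if its naturality squares at monomorphisms are pullbacks. *)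

(* Defs.v *)
From mathcomp Require Import all_boot.
From mathcomp Require Import mathcomp_extra boolp classical_sets functions.
From mathcomp Require Import cardinality filter.

Set Implicit Arguments.
Unset Strict Implicit.
Unset Printing Implicit Defensive.

Local Open Scope classical_set_scope.
Local Open Scope card_scope.

(* A fixed universe of "sets".  [Ob C : Type] below lives in a strictly larger
   universe, so that the category SET of all [smallT] is itself a [category]. *)
Definition smallT := Type.

(** * Categories and functors *)

(* Locally small categories; equality of arrows is Leibniz equality. *)
Record category := Category {
  Ob :> Type;
  hom : Ob -> Ob -> smallT;
  idm : forall a, hom a a;
  comp : forall a b c, hom b c -> hom a b -> hom a c;
  comp1m : forall a b (f : hom a b), comp (idm b) f = f;
  compm1 : forall a b (f : hom a b), comp f (idm a) = f;
  compA : forall a b c d (h : hom c d) (g : hom b c) (f : hom a b),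
    comp h (comp g f) = comp (comp h g) f
}.
Arguments hom {_} a b : rename.
Arguments idm {_} a : rename.
Arguments comp {_ _ _ _} g f : rename.

Declare Scope cat_scope.
Delimit Scope cat_scope with cat.
Notation "g \c f" := (comp g f)
  (at level 50, left associativity, format "g  \c  f") : cat_scope.
Local Open Scope cat_scope.

Record functor (C D : category) := Functor {
  fob :> Ob C -> Ob D;
  fmap : forall a b : C, hom a b -> hom (fob a) (fob b);
  fmap1 : forall a, fmap (idm a) = idm (fob a);
  fmapM : forall a b c (g : hom b c) (f : hom a b),
    fmap (g \c f) = fmap g \c fmap f
}.
Arguments fmap {C D} F {a b} f : rename.

Record nat_trans (C D : category) (F G : functor C D) := NatTrans {
  component :> forall a : C, hom (F a) (G a);
  naturality : forall a b (f : hom a b),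
    component b \c fmap F f = fmap G f \c component a
}.

Definition SET : category.
Proof.
by refine (@Category smallT (fun A B => A -> B) (fun A x => x)
             (fun A B C g f x => g (f x)) _ _ _).
Defined.

Definition opcat (C : category) : category.
Proof.
refine (@Category (Ob C) (fun a b => @hom C b a) (fun a => idm a)
          (fun a b c g f => f \c g) _ _ _).
- by move=> a b f; exact: compm1.
- by move=> a b f; exact: comp1m.
- by move=> a b c d h g f; rewrite compA.
Defined.

Definition full_subcat (C : category) (P : Ob C -> Prop) : category.
Proof.
refine (@Category {a : Ob C | P a} (fun a b => hom (sval a) (sval b))
          (fun a => idm (sval a)) (fun a b c g f => g \c f) _ _ _).
- by move=> a b f; exact: comp1m.
- by move=> a b f; exact: compm1.
- by move=> a b c d h g f; exact: compA.
Defined.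

Definition incl (C : category) (P : Ob C -> Prop) : functor (full_subcat P) C.
Proof.
by refine (@Functor (full_subcat P) C (fun a => sval a) (fun a b f => f) _ _).
Defined.

Definition functor_comp (C D E : category) (G : functor D E) (F : functor C D) :
  functor C E.
Proof.
refine (@Functor C E (fun a => G (F a)) (fun a b f => fmap G (fmap F f)) _ _).
- by move=> a; rewrite !fmap1.
- by move=> a b c g f; rewrite !fmapM.
Defined.

Definition prod_functor (C : category) (I : smallT) (M : I -> functor C SET) :
  functor C SET.
Proof.
refine (@Functor C SET (fun a => forall i, M i a)
          (fun a b f x i => fmap (M i) f (x i)) _ _).
- by move=> a; apply/funext => x; apply: functional_extensionality_dep => i;
    rewrite fmap1.
- by move=> a b c g f; apply/funext => x;
    apply: functional_extensionality_dep => i; rewrite fmapM.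
Defined.

Definition small_category (C : category) : Prop :=
  exists (X : smallT) (e : X -> Ob C), bijective e.

(** * Cardinals *)

(* A cardinal is given by a type [K] of that cardinality; [ksmall K X] says
   that [X] has cardinality strictly less than [K]. *)
Definition ksmall (K X : smallT) : Prop :=
  [set: X] #<= [set: K] /\ ~ ([set: K] #<= [set: X]).

Definition regular_cardinal (K : smallT) : Prop :=
  infinite_set [set: K] /\
  forall (I : smallT) (X : I -> smallT),
    ksmall K I -> (forall i, ksmall K (X i)) -> ksmall K {i : I & X i}.

Definition kcomplete (K : smallT) (S : smallT) (F : set_system S) : Prop :=
  forall (I : smallT) (A : I -> set S),
    ksmall K I -> (forall i, F (A i)) -> F [set x | forall i, A i x].

Definition strongly_compact (K : smallT) : Prop :=
  [/\ ~ countable [set: K], regular_cardinal K &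
    forall (S : smallT) (F : set_system S), ProperFilter F -> kcomplete K F ->
      exists G : set_system S, [/\ UltraFilter G, kcomplete K G & F `<=` G]].

(** * Limits, epimorphisms, unions *)

Section Notions.
Variable C : category.
Implicit Types x y z : C.

Definition mono x y (m : hom x y) : Prop :=
  forall z (f g : hom z x), m \c f = m \c g -> f = g.

Definition iso x y (f : hom x y) : Prop :=
  exists g : hom y x, f \c g = idm y /\ g \c f = idm x.

Definition initial x : Prop := forall y, exists! f : hom x y, True.

Definition is_cone (J : category) (D : functor J C) (l : C)
    (p : forall j, hom l (D j)) : Prop :=
  forall i j (u : hom i j), fmap D u \c p i = p j.

Definition is_limit (J : category) (D : functor J C) (l : C)
    (p : forall j, hom l (D j)) : Prop :=
  is_cone p /\
  forall (z : C) (q : forall j, hom z (D j)), is_cone q ->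
    exists! h : hom z l, forall j, p j \c h = q j.

(* [p] and [q] are the projections of the pullback of [f] and [g]. *)
Definition is_pullback a b c x (f : hom a c) (g : hom b c)
    (p : hom x a) (q : hom x b) : Prop :=
  f \c p = g \c q /\
  forall z (p' : hom z a) (q' : hom z b), f \c p' = g \c q' ->
    exists! h : hom z x, p \c h = p' /\ q \c h = q'.

Definition is_coequalizer r x y (p q : hom r x) (f : hom x y) : Prop :=
  f \c p = f \c q /\
  forall z (g : hom x z), g \c p = g \c q -> exists! h : hom y z, h \c f = g.

Definition effective_epi x y (f : hom x y) : Prop :=
  exists r (p q : hom r x), is_pullback f f p q /\ is_coequalizer p q f.

Definition is_coproduct (I : smallT) (x : I -> C) (c : C)
    (u : forall i, hom (x i) c) : Prop :=
  forall z (f : forall i, hom (x i) z),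
    exists! h : hom c z, forall i, h \c u i = f i.

(* [n] is the supremum of the [m i] in the poset of subobjects of [x]. *)
Definition is_union (I : smallT) (x : C) (s : I -> C)
    (m : forall i, hom (s i) x) (u : C) (n : hom u x) : Prop :=
  [/\ forall i, mono (m i), mono n,
      forall i, exists k : hom (s i) u, n \c k = m i &
      forall t (v : hom t x), mono v ->
        (forall i, exists k : hom (s i) t, v \c k = m i) ->
        exists k : hom u t, v \c k = n].

Definition extremal_epi_family (I : Type) (x : I -> C) (y : C)
    (f : forall i, hom (x i) y) : Prop :=
  forall s (m : hom s y), mono m ->
    (forall i, exists g : hom (x i) s, m \c g = f i) -> iso m.

End Notions.

(* [J] has fewer than [K] arrows in total (hence fewer than [K] objects). *)
Definition ksmall_category (K : smallT) (J : category) : Prop :=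
  exists (X : smallT) (e : X -> {a : J & {b : J & hom a b}}),
    bijective e /\ ksmall K X.

Definition has_ksmall_limits (K : smallT) (C : category) : Prop :=
  forall (J : category) (D : functor J C), ksmall_category K J ->
    exists (l : C) (p : forall j, hom l (D j)), is_limit p.

(* In the pulled back factorization the second factor is automatically mono. *)
Definition has_stable_image_factorizations (C : category) : Prop :=
  forall (x y : C) (f : hom x y),
    exists (i : C) (e : hom x i) (m : hom i y),
      [/\ effective_epi e, mono m, f = m \c e &
        forall (y' i' x' : C) (g : hom y' y)
            (m' : hom i' y') (gi : hom i' i) (e' : hom x' i') (gx : hom x' x),
          is_pullback m g gi m' -> is_pullback e gi gx e' ->
          effective_epi e'].

Definition has_stable_ksmall_unions (K : smallT) (C : category) : Prop :=
  forall (I : smallT) (x : C) (s : I -> C) (m : forall i, hom (s i) x),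
    ksmall K I -> (forall i, mono (m i)) ->
    exists (u : C) (n : hom u x), is_union m n /\
      forall (y : C) (g : hom y x)
          (s' : I -> C) (m' : forall i, hom (s' i) y)
          (gs : forall i, hom (s' i) (s i))
          (u' : C) (n' : hom u' y) (gu : hom u' u),
        (forall i, is_pullback (m i) g (gs i) (m' i)) ->
        is_pullback n g gu n' ->
        is_union m' n'.

Definition has_ksmall_disjoint_coproducts (K : smallT) (C : category) : Prop :=
  forall (I : smallT) (x : I -> C), ksmall K I ->
    exists (c : C) (u : forall i, hom (x i) c),
      [/\ is_coproduct u, forall i, mono (u i) &
        forall i j, i <> j ->
          forall (z : C) (p : hom z (x i)) (q : hom z (x j)),
            is_pullback (u i) (u j) p q -> initial z].

(** * Trees *)

(* Rooted trees of possibly transfinite height. *)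
Record tree := Tree {
  vertex : smallT;
  tle : vertex -> vertex -> Prop;
  tle_refl : forall s, tle s s;
  tle_anti : forall s t, tle s t -> tle t s -> s = t;
  tle_trans : forall s t r, tle r s -> tle s t -> tle r t;
  root : vertex;
  root_le : forall t, tle root t;
  tree_wo : forall (t : vertex) (A : set vertex),
    (forall s, A s -> tle s t /\ s <> t) -> A !=set0 ->
    exists2 r, A r & forall s, A s -> tle r s
}.
Arguments tle {_} s t : rename.
Arguments root {_}.

Definition tree_cat (T : tree) : category.
Proof.
refine (@Category (vertex T) (fun s t => @tle T s t) (fun s => tle_refl s)
          (fun r s t g f => tle_trans f g) _ _ _).
all: by move=> *; exact: Prop_irrelevance.
Defined.

Section Tree.
Variable T : tree.
Implicit Types (s t r : vertex T) (b : set (vertex T)).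

Definition tlt s t : Prop := tle s t /\ s <> t.

(* [s] is an immediate successor of [t] in the tree, i.e. an immediate
   predecessor of [t] in the cotree. *)
Definition child t s : Prop :=
  tlt t s /\ forall r, tlt t r -> ~ tlt r s.

Definition leaf t : Prop := forall s, ~ tlt t s.

Definition chain b : Prop := forall s t, b s -> b t -> tle s t \/ tle t s.

Definition branch b : Prop :=
  chain b /\ forall b', chain b' -> b `<=` b' -> b' `<=` b.

Definition limit_step b t : Prop :=
  [/\ b t, exists2 s, b s & tlt s t &
      forall s, b s -> tlt s t -> exists r, [/\ b r, tlt s r & tlt r t]].

Lemma branch_root b : branch b -> b root.
Proof.
move=> [cb mb].
apply: (mb (fun t => b t \/ t = root)); last by right.
- move=> s t [bs|->] [bt|->].
  + exact: cb.
  + by right; exact: root_le.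
  + by left; exact: root_le.
  + by left; exact: root_le.
- by move=> t bt; left.
Qed.

End Tree.

Definition cotree (T : tree) (C : category) := functor (opcat (tree_cat T)) C.

(* The restriction of a cotree to a set of vertices. *)
Definition restrict (T : tree) (C : category) (X : cotree T C) (A : set (vertex T)) :
    functor (@full_subcat (opcat (tree_cat T)) A) C :=
  functor_comp X (@incl (opcat (tree_cat T)) A).

Definition cotree_map (T : tree) (C : category) (X : cotree T C) (s t : vertex T)
    (h : tle t s) : hom (X s) (X t) :=
  @fmap (opcat (tree_cat T)) C X s t h.

(* Leaves are exempt: a branch ending in a leaf contributes the composite from
   that leaf to the root. *)
Definition locally_covering (K : smallT) (T : tree) (C : category)
    (X : cotree T C) : Prop :=
  forall t : vertex T, ~ leaf t ->
    ksmall K {s : vertex T | child t s} /\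
    extremal_epi_family
      (fun s : {s : vertex T | child t s} => cotree_map X (proj1 (proj1 (svalP s)))).

Definition continuous_branch (T : tree) (C : category) (X : cotree T C)
    (b : set (vertex T)) : Prop :=
  forall t : vertex T, limit_step b t ->
    @is_limit C _ (restrict X (fun s => b s /\ tlt s t)) (X t)
      (fun s => cotree_map X (proj1 (proj2 (svalP s)))).

(* [L b] with projections [p b] ranges over all choices of limits of the
   branches; the arrow [L b -> X root] is the transfinite cocomposition. *)
Definition has_transfinite_covers (K : smallT) (C : category) : Prop :=
  forall (T : tree) (X : cotree T C),
    locally_covering K X ->
    (forall b : set (vertex T), branch b ->
       ksmall K {t : vertex T | b t} /\ continuous_branch X b) ->
    forall (L : {b : set (vertex T) | branch b} -> C)
      (p : forall (b : {b : set (vertex T) | branch b}) (t : {t : vertex T | sval b t}),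
         hom (L b) (X (sval t))),
      (forall b, @is_limit C _ (restrict X (sval b)) (L b) (p b)) ->
      @extremal_epi_family C _ L (X root)
        (fun b => p b (exist (sval b) root (branch_root (svalP b)))).

(** * Coherence, regularity, elementary transformations *)

(* (kappa,kappa)-coherent categories, kappa being the cardinality of [K]. *)
Definition coherent_category (K : smallT) (C : category) : Prop :=
  [/\ has_ksmall_limits K C, has_stable_image_factorizations C,
      has_stable_ksmall_unions K C & has_transfinite_covers K C].

Definition preserves_ksmall_limits (K : smallT) (C D : category)
    (F : functor C D) : Prop :=
  forall (J : category) (X : functor J C) (l : C) (p : forall j, hom l (X j)),
    ksmall_category K J -> is_limit p ->
    @is_limit D J (functor_comp F X) (F l) (fun j => fmap F (p j)).

Definition preserves_effective_epis (C D : category) (F : functor C D) : Prop :=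
  forall (x y : C) (f : hom x y), effective_epi f -> effective_epi (fmap F f).

Definition preserves_ksmall_unions (K : smallT) (C D : category)
    (F : functor C D) : Prop :=
  forall (I : smallT) (x : C) (s : I -> C) (m : forall i, hom (s i) x)
      (u : C) (n : hom u x),
    ksmall K I -> is_union m n -> is_union (fun i => fmap F (m i)) (fmap F n).

Definition regular_functor (K : smallT) (C D : category) (F : functor C D) :=
  preserves_ksmall_limits K F /\ preserves_effective_epis F.

Definition coherent_functor (K : smallT) (C D : category) (F : functor C D) :=
  [/\ preserves_ksmall_limits K F, preserves_effective_epis F &
      preserves_ksmall_unions K F].

Definition elementary (C D : category) (F G : functor C D)
    (alpha : nat_trans F G) : Prop :=
  forall (x y : C) (m : hom x y), mono m ->
    is_pullback (alpha y) (fmap G m) (fmap F m) (alpha x).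

(* Main.v *)
From mathcomp Require Import all_boot.
From mathcomp Require Import mathcomp_extra boolp classical_sets functions.
From mathcomp Require Import cardinality filter wochoice.
Require Import Defs.

Set Implicit Arguments.
Unset Strict Implicit.
Unset Printing Implicit Defensive.

Local Open Scope classical_set_scope.
Local Open Scope card_scope.
Local Open Scope cat_scope.

(** The proof produces, for each mono [m : x0 -> y0] and each [a] in [F y0]
outside the image of [F m], a coherent functor [M] and a transformation
[F => M] that keeps [a] outside the image of [M m].  The product of these [M],
over the small set of all such pairs of [m] and [a], then receives an elementary
transformation: the naturality square at [m] is a pullback because an element
that leaves [F m] is caught by one of the factors.

A regular [F] fails to be coherent because it does not see which piece of a
disjoint decomposition an element belongs to.  Let [two = 1 + 1].  The set
[F two] is a Boolean algebra of propositions, over which [F] is a sheaf in the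
sense that [F (x + 1)] consists of the elements of [F x] defined on some
proposition.  A kappa-complete ultrafilter on [F two] therefore has a stalk,
the functor [localization]: its elements at [x] are the elements of [F (x + 1)]
defined on a large proposition, up to equality on a large proposition.  The
stalk decides every kappa-small disjoint decomposition, so it preserves
kappa-small coproducts; it still preserves limits and effective epimorphisms,
and a union is an effective quotient of a coproduct.

The ultrafilter is a valuation [s : F two -> bool].  It has to be consistent,
not with the algebra [F two] alone, but with the demand that [a] stay outside
[m].  Both are expressed by [avoiding]: whenever an element [e] of [F z] lies
over [a] and kappa-many maps [chi i : z -> two] are given, the part of [z] on
which each [chi i] is constantly the truth value that [s] assigns to it at [e]
is not carried into [m].  For one such request a valuation exists
([local_valuation]): the parts of [z] on which all [chi i] are constant cover
[z], so if all of them went into [m], then so would [z], hence [a].  That these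
parts do cover [z] is [constant_cover]; it is the point where the transfinite
covers are used, along the tree of partial assignments of truth values to the
[chi i], in a well-ordering of the index set.  The requests are closed under
kappa-small conjunction because [F] preserves kappa-small limits, so the
valuations meeting them generate a kappa-complete filter, and strong compactness
extends it to a kappa-complete ultrafilter on the set of all valuations, from
which a single valuation is read off ([avoiding_exists]).

Statements about the stalk are made with the relation [forces e R]: the
property [R] of maps into [z] holds, at the element [e] of [F z], on a large
part of [z].  It is closed under kappa-small conjunction and pullback, it
decides disjoint decompositions ([forces_inj]), and it lets maps defined on a
large part be extended to partial maps on a whole object ([forces_extend]). *)
(** * Small cardinals and complete ultrafilters *)

Lemma card_leTP (X Y : Type) :
  [set: X] #<= [set: Y] <-> exists f : X -> Y, injective f.
Proof.
split.
  move=> h; elim/Ppointed: Y => Y in h *.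
    have x0 : [set: X] = set0 by move: h; rewrite card_le_emptyr => /eqP.
    have noX (x : X) : False by have : [set: X] x by []; rewrite x0.
    by exists (fun x => False_rect _ (noX x)) => x.
  by have /pcard_injP[f fi] := h; exists f => x x' e; apply: fi; rewrite ?inE.
move=> [f fi]; elim/Ppointed: Y => Y in f fi *.
  suff -> : [set: X] = set0 by rewrite card_ge0.
  by apply/seteqP; split=> // x _; have : [set: Y] (f x) by []; rewrite emptyE.
by apply/pcard_injP; exists f => x x' _ _; exact: fi.
Qed.

Lemma ksmall_inj (K X Y : smallT) (f : X -> Y) :
  injective f -> ksmall K Y -> ksmall K X.
Proof.
move=> fi [YK KY]; have XY : [set: X] #<= [set: Y] by apply/card_leTP; exists f.
by split; [exact: card_le_trans XY YK | move=> /card_le_trans/(_ XY)].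
Qed.

Lemma ksmall_nat (K X : smallT) :
  [set: K] #= [set: nat] -> ksmall K X <-> finite_set [set: X].
Proof.
move=> eK; rewrite /ksmall (card_le_eql eK) (card_le_eqr eK).
split=> [[_ h]|fX]; first by apply: contrapT => /infiniteP.
split; first exact: finite_set_countable.
by move=> /infiniteP.
Qed.

Lemma finite_sigma (I : Type) (X : I -> Type) :
  finite_set [set: I] -> (forall i, finite_set [set: X i]) ->
  finite_set [set: {i : I & X i}].
Proof.
move=> fI fX.
pose A i := (fun x : X i => existT X i x) @` setT.
suff -> : [set: {i & X i}] = \bigcup_(i in setT) A i.
  by apply: bigcup_finite => // i _; exact: finite_image.
by apply/seteqP; split=> // -[i x] _; exists i => //; exists x.
Qed.

(** The common ground of the case of aleph_0 and of the strongly compact case. *)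
Definition compact_cardinal (K : smallT) : Prop :=
  regular_cardinal K /\
  forall (S : smallT) (F : set_system S), ProperFilter F -> kcomplete K F ->
    exists G : set_system S, [/\ UltraFilter G, kcomplete K G & F `<=` G].

(** For aleph_0, small means finite: every filter is complete, and the
ultrafilter lemma takes the place of strong compactness. *)
Lemma compact_cardinal_intro (K : smallT) :
  [set: K] #= [set: nat] \/ strongly_compact K -> compact_cardinal K.
Proof.
move=> [eK|[_ rK cK]] //; have sK X := ksmall_nat X eK.
split; first split.
- by apply/infiniteP; rewrite (card_le_eqr eK).
- move=> I X /sK fI fX; apply/sK/finite_sigma => // i; exact/sK.
- move=> S F PF _; have [G [UG FG]] := ultraFilterLemma PF.
  exists G; split=> // I A /sK fI GA.
  have PG := @ultra_proper _ _ UG.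
  have -> : [set x | forall i, A i x] = \bigcap_(i in [set: I]) A i.
    by apply/seteqP; split=> x h i; [move=> _; exact: h|exact: h].
  elim/Pchoice: I => I in A fI GA *.
  have /finite_fsetP[D ->] := fI.
  exact: filter_bigI.
Qed.

Section SmallTypes.
Variables (K : smallT) (rK : regular_cardinal K).

Lemma ksmall_finite (X : smallT) : finite_set [set: X] -> ksmall K X.
Proof.
move=> fX; have [iK _] := rK; split; last first.
  by move=> /card_le_finite/(_ fX).
have /infiniteP nK := iK.
by apply: card_le_trans nK; exact: finite_set_countable.
Qed.

Lemma ksmall_unit : ksmall K unit. Proof. by apply: ksmall_finite. Qed.
Lemma ksmall_bool : ksmall K bool. Proof. by apply: ksmall_finite. Qed.

Lemma ksmall_empty (X : smallT) : (X -> False) -> ksmall K X.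
Proof.
move=> nX; apply: (@ksmall_inj K X bool (fun x => False_rect _ (nX x))).
  by move=> x.
exact: ksmall_bool.
Qed.

Lemma ksmall_sig (I : smallT) (X : I -> smallT) :
  ksmall K I -> (forall i, ksmall K (X i)) -> ksmall K {i : I & X i}.
Proof. by have [_] := rK; apply. Qed.

Lemma ksmall_prod (X Y : smallT) : ksmall K X -> ksmall K Y -> ksmall K (X * Y)%type.
Proof.
move=> kX kY; apply: (ksmall_inj (f := fun p : X * Y => existT (fun=> Y) p.1 p.2)).
  move=> [x y] [x' y'] /= e.
  by rewrite (congr1 (@projT1 _ _) e : x = x') (congr1 (fun s => projT2 s : Y) e : y = y').
by apply: ksmall_sig.
Qed.

Lemma ksmall_option (X : smallT) : ksmall K X -> ksmall K (option X).
Proof.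
move=> kX; pose Y (b : bool) : smallT := if b then X else unit.
pose f (o : option X) : {b & Y b} :=
  if o is Some x then existT Y true x else existT Y false tt.
pose g (s : {b & Y b}) : option X :=
  match s with existT true x => Some x | existT false _ => None end.
apply: (ksmall_inj (f := f)).
  by apply: (can_inj (g := g)); case.
by apply: ksmall_sig => [|[]]; rewrite ?/Y; [exact: ksmall_bool| |exact: ksmall_unit].
Qed.

End SmallTypes.

(** * Limits over small diagrams *)

Section Basics.
Variable C : category.
Implicit Types s t v x y z : C.

(** For a mono [n], this says that [j] lands in the subobject [n].  Surjectivity
of [n] is expressed as [through n (idm v)]. *)
Definition through (t v s : C) (n : hom t v) (j : hom s v) : Prop :=
  exists k, n \c k = j.

Lemma mono_section_iso t v (n : hom t v) : mono n -> through n (idm v) -> iso n.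
Proof.
move=> mn [k nk]; exists k; split=> //; apply: mn.
by rewrite compA nk comp1m compm1.
Qed.

Lemma initial_uniq x y (f g : hom x y) : initial x -> f = g.
Proof. by move=> /(_ y)[h [_ u]]; rewrite -(u f) // -(u g). Qed.

Lemma initial_arrow x y : initial x -> inhabited (hom x y).
Proof. by move=> /(_ y)[h _]; exists. Qed.

End Basics.

Definition discrete (T : smallT) : category.
Proof.
refine (@Category T (fun a b => a = b) (fun a => erefl)
          (fun a b c (g : b = c) (f : a = b) => etrans f g) _ _ _).
all: by move=> *; exact: Prop_irrelevance.
Defined.

Definition discrete_functor (T : smallT) (C : category) (w : T -> C) :
  functor (discrete T) C.
Proof.
refine (@Functor (discrete T) C w
  (fun a b (e : a = b) => match e in _ = b return hom (w a) (w b) with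
    erefl => idm (w a) end) _ _) => //.
by move=> a b c; case: c / ; case: b /; rewrite /= comp1m.
Defined.

(** The shape of a family of parallel pairs with a common source [None]. *)
Section Fork.
Variable I : smallT.

Definition fork_hom (a b : option I) : smallT :=
  match a, b with
  | None, None => unit
  | None, Some _ => bool
  | Some _, None => void
  | Some i, Some j => i = j
  end.

Definition fork_id (a : option I) : fork_hom a a :=
  if a is Some i then erefl else tt.

Definition fork_comp (a b c : option I) :
  fork_hom b c -> fork_hom a b -> fork_hom a c :=
  match a, b, c with
  | None, None, _ => fun g _ => g
  | None, Some _, Some _ => fun _ f => f
  | None, Some _, None => fun g _ => match g with end
  | Some _, None, _ => fun _ f => match f with end
  | Some _, Some _, None => fun g _ => g
  | Some _, Some _, Some _ => fun g f => etrans f g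
  end.

Definition fork : category.
Proof.
refine (@Category (option I) fork_hom fork_id fork_comp _ _ _).
- by move=> [i|] [j|] //= f; case: f.
- by move=> [i|] [j|] //= f; case: j / f.
- move=> [i|] [j|] [k|] [l|] //= h g f; try exact: Prop_irrelevance.
  all: by case: h || case: g || case: f.
Defined.

Variables (C : category) (w : C) (z : I -> C) (f g : forall i, hom w (z i)).

Definition fork_ob (a : option I) : C := if a is Some i then z i else w.

Definition fork_map (a b : option I) : fork_hom a b -> hom (fork_ob a) (fork_ob b) :=
  match a, b with
  | None, None => fun _ => idm w
  | None, Some i => fun s => if s then f i else g i
  | Some _, None => fun e => match e with end
  | Some i, Some j => fun e => match e in _ = j return hom (z i) (z j) with
                        erefl => idm (z i) end
  end.

Definition fork_functor : functor fork C.
Proof.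
refine (@Functor fork C fork_ob fork_map _ _).
- by case.
- move=> [i|] [j|] [k|] //= v u; rewrite ?compm1 ?comp1m //.
  + by move: u v => /= u v; destruct v, u; rewrite comp1m.
  + by move: v => /= v; destruct v; rewrite comp1m.
Defined.

End Fork.

Section Limits.
Variables (K : smallT) (rK : regular_cardinal K) (C : category).
Hypothesis limC : has_ksmall_limits K C.

(** A limit-preserving functor to sets sends a limit to the set of compatible
families. *)
Lemma lex_elem (F : functor C SET) (J : category) (X : functor J C) l
    (p : forall j, hom l (X j)) (d : forall j, F (X j)) :
  preserves_ksmall_limits K F -> ksmall_category K J -> is_limit p ->
  (forall i j (u : hom i j), fmap F (fmap X u) (d i) = d j) ->
  exists e : F l, forall j, fmap F (p j) e = d j.
Proof.
move=> pF kJ lp dc; have [_ u] := pF _ _ _ _ kJ lp.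
have [|h [hE _]] := u (unit : SET) (fun j _ => d j).
  by move=> i j v; apply/funext => -[]; exact: dc.
by exists (h tt) => j; exact: (congr1 (fun k => k tt) (hE j)).
Qed.

Lemma ksmall_subsingleton (X : smallT) : (forall x y : X, x = y) -> ksmall K X.
Proof.
move=> X1; apply: (ksmall_inj (f := fun=> tt)) (ksmall_unit rK).
by move=> x y _; exact: X1.
Qed.

Lemma discrete_ksmall (T : smallT) : ksmall K T -> ksmall_category K (discrete T).
Proof.
move=> kT; exists {a : T & {b : T & a = b}}, id; split; first by exists id.
apply: (ksmall_sig rK) => // a; apply: (ksmall_sig rK) => // b.
by apply: ksmall_subsingleton => *; exact: Prop_irrelevance.
Qed.

Lemma fork_ksmall (I : smallT) : ksmall K I -> ksmall_category K (fork I).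
Proof.
move=> kI; exists {a : option I & {b : option I & fork_hom a b}}, id.
split; first by exists id.
have kO := ksmall_option rK kI.
apply: (ksmall_sig rK) => // a; apply: (ksmall_sig rK) => // b.
case: a b => [i|] [j|] /=; last exact: ksmall_unit.
- by apply: ksmall_subsingleton => *; exact: Prop_irrelevance.
- exact: ksmall_empty.
- exact: ksmall_bool.
Qed.

(** Limits in [C] come together with the corresponding statement about the
elements of limit-preserving functors, which is how the hypothesis on [F] enters
later on. *)
Lemma product_exists (T : smallT) (w : T -> C) : ksmall K T ->
  exists (l : C) (p : forall t, hom l (w t)),
    (forall v (q : forall t, hom v (w t)), exists! h, forall t, p t \c h = q t) /\
    forall F : functor C SET, preserves_ksmall_limits K F ->
      forall d : (forall t, F (w t)), exists e, forall t, fmap F (p t) e = d t.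
Proof.
move=> kT; have kJ := discrete_ksmall kT.
have [l [p lp]] := limC (discrete_functor w) kJ.
exists l, p; split.
  move=> v q; apply: (proj2 lp) => i j u; case: j / u; exact: comp1m.
move=> F pF d; apply: (lex_elem pF kJ lp) => i j u.
by case: j / u; rewrite /= fmap1.
Qed.

Lemma joint_equalizer_exists (I : smallT) (w : C) (z : I -> C)
    (f g : forall i, hom w (z i)) : ksmall K I ->
  exists (v : C) (n : hom v w),
  [/\ mono n, forall i, f i \c n = g i \c n,
      forall u (h : hom u w), (forall i, f i \c h = g i \c h) -> through n h &
      forall F : functor C SET, preserves_ksmall_limits K F ->
        forall d : F w, (forall i, fmap F (f i) d = fmap F (g i) d) ->
        exists e, fmap F n e = d].
Proof.
move=> kI; have kJ := fork_ksmall kI.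
have [l [p lp]] := limC (fork_functor f g) kJ; have [cp up] := lp.
have fE i : f i \c p None = p (Some i) := cp None (Some i) true.
have gE i : g i \c p None = p (Some i) := cp None (Some i) false.
have univ u (h : hom u w) : (forall i, f i \c h = g i \c h) ->
    exists! k, p None \c k = h.
  move=> hE.
  have [|k [kE ku]] := up u (fun a : option I =>
      if a is Some i return hom u (fork_ob w z a) then f i \c h else h).
    move=> [i|] [j|] //= e; first by case: j / e; rewrite comp1m.
      by case: e => //; rewrite -hE.
    by rewrite comp1m.
  exists k; split; first exact: (kE None).
  move=> k' k'E; apply: ku => -[i|] //=.
  by rewrite -fE -compA k'E.
exists l, (p None); split=> [s a b e|i|u h /univ[k [kE _]]|F pF d dE].
- have [|k [_ ku]] := univ s (p None \c a).
    by move=> i; rewrite !compA fE gE.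
  by rewrite -(ku a) // -(ku b).
- by rewrite fE gE.
- by exists k.
- pose d' (a : option I) : F (fork_ob w z a) :=
    if a is Some i return F (fork_ob w z a) then fmap F (f i) d else d.
  have [|e eE] := @lex_elem F (fork I) (fork_functor f g) l p d' pF kJ lp.
    move=> [i|] [j|] //= e; first by case: j / e; rewrite fmap1.
      by case: e => //; rewrite -dE.
    by rewrite fmap1.
  by exists e; exact: (eE None).
Qed.

Lemma pullback_exists (a b c : C) (f : hom a c) (g : hom b c) :
  exists (x : C) (p : hom x a) (q : hom x b), is_pullback f g p q.
Proof.
have [l [p [up _]]] :=
  product_exists (fun s : bool => if s then a else b) (ksmall_bool rK).
have [v [n [mn nE un _]]] := @joint_equalizer_exists unit l (fun=> c)
  (fun=> f \c p true) (fun=> g \c p false) (ksmall_unit rK).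
exists v, (p true \c n), (p false \c n); split.
  by rewrite !compA (nE tt).
move=> z p' q' e.
have [h [hE hu]] := up z (fun s : bool =>
  if s return hom z (if s then a else b) then p' else q').
have hT : p true \c h = p' := hE true.
have hF : p false \c h = q' := hE false.
have [|k kE] := un z h; first by move=> _; rewrite -!compA hT hF.
exists k; split; first by rewrite -!compA kE.
move=> k' [eT eF]; apply: mn; rewrite kE; apply: hu => -[]; by rewrite compA.
Qed.

Lemma pullback_mono (a b c x : C) (f : hom a c) (g : hom b c)
    (p : hom x a) (q : hom x b) : is_pullback f g p q -> mono f -> mono q.
Proof.
move=> [e u] mf z h k hk; have [|l [_ lu]] := u z (p \c h) (q \c h).
  by rewrite !compA e.
rewrite -(lu h) // -(lu k) //; split; last by rewrite hk.
by apply: mf; rewrite !compA e -!compA hk.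
Qed.

Lemma terminal_exists : exists one : C, forall x, exists! f : hom x one, True.
Proof.
have [l [p [up _]]] :=
  @product_exists void (fun i => match i with end) (ksmall_empty rK (of_void _)).
exists l => x; have [h [_ hu]] := up x (fun i => match i with end).
by exists h; split=> // h' _; apply: hu; case.
Qed.

End Limits.

(** * Coproducts and covers *)

Section Coproducts.
Variables (K : smallT) (rK : regular_cardinal K) (C : category).
Hypothesis limC : has_ksmall_limits K C.
Hypothesis uniC : has_stable_ksmall_unions K C.
Hypothesis copC : has_ksmall_disjoint_coproducts K C.
Implicit Types s t v w x y z : C.

Section Chosen.
Variables (I : smallT) (B : I -> C) (kI : ksmall K I).

Definition cop : C := sval (cid (copC B kI)).

Definition inj : forall i, hom (B i) cop := sval (cid (svalP (cid (copC B kI)))).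

Lemma inj_spec : [/\ is_coproduct inj, forall i, mono (inj i) &
  forall i j, i <> j -> forall v (p : hom v (B i)) (q : hom v (B j)),
    is_pullback (inj i) (inj j) p q -> initial v].
Proof. exact: svalP (cid (svalP (cid (copC B kI)))). Qed.

Lemma inj_mono i : mono (inj i). Proof. by have [_] := inj_spec. Qed.

Definition copair z (f : forall i, hom (B i) z) : hom cop z :=
  let: And3 u _ _ := inj_spec in sval (cid (u z f)).

Lemma copairE z (f : forall i, hom (B i) z) i : copair f \c inj i = f i.
Proof. by rewrite /copair; case: inj_spec => u _ _; case: cid => h []. Qed.

Lemma cop_ext z (f g : hom cop z) : (forall i, f \c inj i = g \c inj i) -> f = g.
Proof.
move=> fg; have [u _ _] := inj_spec.
have [h [_ hu]] := u z (fun i => f \c inj i).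
by rewrite -(hu f) // -(hu g).
Qed.

(** The injections have the coproduct as their union, because the coproduct
splits any subobject containing them; and unions are stable under pullback along
[g]. *)
Lemma cop_cover v (g : hom v cop) t (n : hom t v) : mono n ->
  (forall i s (j : hom s v) (k : hom s (B i)), g \c j = inj i \c k -> through n j) ->
  through n (idm v).
Proof.
move=> mn cov.
have [u [m [[_ mm thr _] stable]]] := uniC kI inj_mono.
have [r [mr rm]] : iso m.
  apply: mono_section_iso => //; pose k i := sval (cid (thr i)).
  exists (copair k); apply: cop_ext => i.
  by rewrite -compA copairE comp1m /k; case: cid.
have pb i := pullback_exists rK limC (inj i) g.
pose s i := sval (cid (pb i)).
pose gs i : hom (s i) (B i) := sval (cid (svalP (cid (pb i)))).
pose m' i : hom (s i) v := sval (cid (svalP (cid (svalP (cid (pb i)))))).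
have pbP i : is_pullback (inj i) g (gs i) (m' i).
  exact: svalP (cid (svalP (cid (svalP (cid (pb i)))))).
have [|_ _ _ least] := stable v g s m' gs v (idm v) (r \c g) pbP.
  split; first by rewrite compA mr comp1m compm1.
  move=> z p' q' e; exists q'; split.
    by rewrite -compA -e compA rm !comp1m.
  by move=> q'' [_ <-]; rewrite comp1m.
apply: least => // i; apply: (cov i _ _ (gs i)).
by have [e _] := pbP i.
Qed.

End Chosen.

Definition zero : C := cop (fun i : void => match i with end) (ksmall_empty rK (of_void _)).

Lemma initial_zero : initial zero.
Proof.
move=> y; exists (copair _ (fun i : void => match i with end)); split=> // f _.
by apply: cop_ext; case.
Qed.

(** The empty family covers [zero], hence also [v].  So the equalizer of two maps
out of [v], which trivially contains the members of this cover, is all of [v]. *)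
Lemma strict_initial v : hom v zero -> initial v.
Proof.
move=> g y; have [h] := initial_arrow y initial_zero.
exists (h \c g); split=> // f _.
have [t [n [mn nE _ _]]] := joint_equalizer_exists rK limC
  (fun=> h \c g) (fun=> f) (ksmall_unit rK).
have [|k nk] := @cop_cover _ _ _ v g t n mn; first by case.
by rewrite -[LHS]compm1 -[RHS]compm1 -nk !compA (nE tt).
Qed.

Lemma initial_comp v w : hom v w -> initial w -> initial v.
Proof.
by move=> g iw; have [h] := initial_arrow zero iw; exact: strict_initial (h \c g).
Qed.

Lemma initial_mono x y (n : hom x y) : initial x -> mono n.
Proof. by move=> ix z f g _; apply: initial_uniq; exact: initial_comp f ix. Qed.

Section Factor.
Variables (I : smallT) (B : I -> C) (kI : ksmall K I).

Lemma inj_disjoint i i' v (k : hom v (B i)) (k' : hom v (B i')) : i <> i' ->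
  inj B kI i \c k = inj B kI i' \c k' -> initial v.
Proof.
move=> ne e; have [_ _ dis] := inj_spec B kI.
have [P [p [q pb]]] := pullback_exists rK limC (inj B kI i) (inj B kI i').
have [h _] := proj2 pb _ _ _ e.
exact: initial_comp h (dis _ _ ne _ _ _ pb).
Qed.

(** The pullback of [inj i] along [g] contains the pullbacks of the other
injections, since these are initial; by [cop_cover] it is everything. *)
Lemma through_inj v (g : hom v (cop B kI)) i :
  (forall i' s (j : hom s v) (k : hom s (B i')), i' <> i ->
     g \c j = inj B kI i' \c k -> initial s) ->
  through (inj B kI i) g.
Proof.
move=> ini; have [P [p [q pb]]] := pullback_exists rK limC (inj B kI i) g.
have [||l ql] := @cop_cover _ B kI v g P q.
- by apply: pullback_mono pb _; exact: inj_mono.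
- move=> i' s j k e; have [ii|ne] := pselect (i' = i).
    case: i / ii ini P p q pb => ini P p q [_ u].
    by have [|h [[_ hq] _]] := u s k j; [by []|exists h].
  have is0 := ini _ _ _ _ ne e; have [h] := initial_arrow P is0.
  by exists h; exact: initial_uniq.
- by exists (p \c l); rewrite compA (proj1 pb) -compA ql compm1.
Qed.

Lemma cop_initial v (g : hom v (cop B kI)) :
  (forall i s (j : hom s v) (k : hom s (B i)), g \c j = inj B kI i \c k -> initial s) ->
  initial v.
Proof.
move=> ini; have [n] := initial_arrow v initial_zero.
have [||l _] := @cop_cover _ B kI v g zero n.
- exact: initial_mono initial_zero.
- move=> i s j k e; have is0 := ini _ _ _ _ e.
  by have [h] := initial_arrow zero is0; exists h; exact: initial_uniq.
- exact: strict_initial.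
Qed.

End Factor.

(** * Truth values *)

Definition one : C := sval (cid (terminal_exists rK limC)).

Definition bang x : hom x one := sval (cid (svalP (cid (terminal_exists rK limC)) x)).

Lemma bang_uniq x (f g : hom x one) : f = g.
Proof.
by have [h [_ u]] := svalP (cid (terminal_exists rK limC)) x; rewrite -(u f) // -(u g).
Qed.

(** [plus x] is [x + 1], which classifies partial maps into [x] with complemented
domain. *)
Definition plus_fam x (b : bool) : C := if b then x else one.
Definition plus x : C := cop (plus_fam x) (ksmall_bool rK).
Definition inl x : hom x (plus x) := inj (plus_fam x) (ksmall_bool rK) true.
Definition inr x : hom one (plus x) := inj (plus_fam x) (ksmall_bool rK) false.

Definition plus_pair x z (f : hom x z) (g : hom one z) : hom (plus x) z :=
  copair (ksmall_bool rK) (fun b : bool => if b return hom (plus_fam x b) z then f else g).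

Lemma plus_pair_inl x z (f : hom x z) g : plus_pair f g \c inl x = f.
Proof. exact: (copairE (B := plus_fam x) _ _ true). Qed.

Lemma plus_pair_inr x z (f : hom x z) g : plus_pair f g \c inr x = g.
Proof. exact: (copairE (B := plus_fam x) _ _ false). Qed.

Lemma inl_mono x : mono (inl x).
Proof. exact: (@inj_mono _ (plus_fam x) (ksmall_bool rK) true). Qed.

Lemma plus_ext x z (f g : hom (plus x) z) :
  f \c inl x = g \c inl x -> f \c inr x = g \c inr x -> f = g.
Proof. by move=> fl fr; apply: cop_ext => -[]. Qed.

Lemma inl_inr x v (k : hom v x) (k' : hom v one) :
  inl x \c k = inr x \c k' -> initial v.
Proof. by apply: (@inj_disjoint _ (plus_fam x) _ true false). Qed.

Definition plus_map x y (f : hom x y) : hom (plus x) (plus y) :=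
  plus_pair (inl y \c f) (inr y).

Lemma plus_map_inl x y (f : hom x y) : plus_map f \c inl x = inl y \c f.
Proof. exact: plus_pair_inl. Qed.

Lemma plus_map1 x : plus_map (idm x) = idm (plus x).
Proof.
by apply: plus_ext; rewrite ?plus_pair_inl ?plus_pair_inr comp1m ?compm1.
Qed.

Lemma plus_mapM x y z (g : hom y z) (f : hom x y) :
  plus_map (g \c f) = plus_map g \c plus_map f.
Proof.
apply: plus_ext; rewrite -[RHS]compA.
  by rewrite !plus_map_inl !compA plus_map_inl.
by rewrite !plus_pair_inr.
Qed.

(** The object of truth values; [const b x] is the truth value [b] at stage [x]. *)
Definition two : C := plus one.

Definition const (b : bool) x : hom x two := (if b then inl one else inr one) \c bang x.

Lemma const_comp b x y (f : hom x y) : const b y \c f = const b x.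
Proof. by rewrite /const -compA (bang_uniq (_ \c f) (bang x)). Qed.

Lemma const_initial b x : const b x = const (~~ b) x -> initial x.
Proof. by case: b => [|/esym] /inl_inr. Qed.

(** A map [z -> two] splits [z] into the part where it is true and the part where
it is false. *)
Lemma two_cover z (chi : hom z two) t (n : hom t z) : mono n ->
  (forall b s (j : hom s z), chi \c j = const b s -> through n j) ->
  through n (idm z).
Proof.
move=> mn cov; apply: (cop_cover (g := chi)) => // b s j k e.
apply: (cov b); rewrite e /const; case: b k {e} => k.
  by rewrite (bang_uniq k (bang s)).
by rewrite (bang_uniq k (bang s)).
Qed.

Section Classifier.
Variables (I : smallT) (B : I -> C) (kI : ksmall K I).

Definition classifier (i : I) : hom (cop B kI) two :=
  copair kI (fun i' => const `[< i' = i >] (B i')).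

Lemma classifierE i i' v (k : hom v (B i')) :
  classifier i \c (inj B kI i' \c k) = const `[< i' = i >] v.
Proof. by rewrite compA copairE const_comp. Qed.

Lemma classifier_through i v (g : hom v (cop B kI)) :
  classifier i \c g = const true v -> through (inj B kI i) g.
Proof.
move=> e; apply: through_inj => i' s j k ne gj.
have := classifierE i k; rewrite -gj compA e const_comp.
by rewrite (asboolF ne) => /const_initial.
Qed.

Lemma classifier_initial v (g : hom v (cop B kI)) :
  (forall i, classifier i \c g = const false v) -> initial v.
Proof.
move=> e; apply: (cop_initial (g := g)) => i s j k gj.
have := classifierE i k; rewrite -gj compA e const_comp.
by rewrite asboolT // => /const_initial.
Qed.

End Classifier.

End Coproducts.

(** * Effective epimorphisms *)

Section EffectiveEpi.
Variable C : category.
Implicit Types t x y z : C.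

(** Effective epimorphisms are recognized by this condition, which only speaks
of subobjects and is therefore accessible to covering arguments. *)
Definition extremal x y (f : hom x y) : Prop :=
  forall t (n : hom t y), mono n -> through n f -> through n (idm y).

Lemma effective_extremal x y (f : hom x y) : effective_epi f -> extremal f.
Proof.
move=> [r [p [q [[e _] [_ u]]]]] t n mn [k nk].
have [|h [hf _]] := u t k.
  by apply: mn; rewrite !compA nk.
exists h; have [h' [_ h'u]] := u _ f e.
rewrite -(h'u (idm y)) ?comp1m //; symmetry; apply: h'u.
by rewrite -compA hf.
Qed.

Lemma extremal_effective x y (f : hom x y) :
  has_stable_image_factorizations C -> extremal f -> effective_epi f.
Proof.
move=> imC ef; have [i [e [m [[r [p [q [[pq up] [_ ue]]]]] mm fE _]]]] := imC _ _ f.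
have [m' [mm' m'm]] : iso m.
  by apply: mono_section_iso => //; apply: ef => //; exists e.
exists r, p, q; split; split.
- by rewrite fE -!compA pq.
- move=> z p' q'; rewrite fE -!compA => /mm; exact: up.
- by rewrite fE -!compA pq.
- move=> z g /ue[h [hE hu]]; exists (h \c m'); split.
    by rewrite fE compA -(compA h) m'm compm1.
  move=> h' h'E; rewrite (hu (h' \c m)) -?compA ?mm' ?compm1 //.
  by rewrite -fE.
Qed.

End EffectiveEpi.

(** * The transfinite cover by constant truth values *)

Lemma well_order_exists (I : Type) : exists le : I -> I -> Prop,
  [/\ forall i j, le i j \/ le j i,
      forall i j, le i j -> le j i -> i = j,
      forall i j k, le i j -> le j k -> le i k &
      forall A : set I, A !=set0 -> exists2 i, A i & forall j, A j -> le i j].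
Proof.
elim/Pchoice: I => I; have [R wR] := well_ordering_principle I.
have wo (A : set I) : A !=set0 -> exists2 i, A i & forall j, A j -> R i j.
  move=> [a Aa]; have [|i [[Ai im] _]] := wR (fun i => `[< A i >]).
    by exists a; apply/asboolP.
  by exists i; [exact/asboolP | move=> j Aj; apply: im; apply/asboolP].
have anti i j : R i j -> R j i -> i = j.
  move=> ij ji; have [|k [_ ku]] := wR (fun k => (k == i) || (k == j)).
    by exists i; apply/orP; left; exact: eqxx.
  have refl l : R l l.
    have [|m -> h] := wo [set l]; first by exists l.
    exact: h.
  have ki : k = i.
    by apply: ku; split; [apply/orP; left; exact: eqxx | move=> l /orP[] /eqP ->].
  have kj : k = j.
    by apply: ku; split; [apply/orP; right; exact: eqxx | move=> l /orP[] /eqP ->].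
  by rewrite -ki.
have tot i j : R i j \/ R j i.
  have [|k [->|->] h] := wo [set i; j]; first by exists i; left.
    by left; apply: h; right.
  by right; apply: h; left.
exists R; split=> // i j k ij jk.
have [|l [[->|->]|->] h] := wo [set i; j; k].
- by exists i; left; left.
- by apply: h; right.
- have ji : R j i by apply: h; left; left.
  by rewrite (anti _ _ ij ji).
- have kj : R k j by apply: h; left; right.
  by rewrite -(anti _ _ jk kj).
Qed.

(** Partial truth assignments defined on an initial segment of a well-ordered
set, ordered by extension. *)
Section Assignments.
Variables (I : smallT) (le : I -> I -> Prop).
Hypothesis le_total : forall i j, le i j \/ le j i.
Hypothesis le_anti : forall i j, le i j -> le j i -> i = j.
Hypothesis le_trans : forall i j k, le i j -> le j k -> le i k.
Hypothesis le_wo :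
  forall A : set I, A !=set0 -> exists2 i, A i & forall j, A j -> le i j.

Definition segment (f : I -> option bool) : Prop :=
  forall i j, le j i -> f i <> None -> f j <> None.

Definition asg : smallT := {f : I -> option bool | segment f}.
Implicit Types s t r : asg.

Definition ext s t : Prop := forall i, sval s i <> None -> sval t i = sval s i.

Lemma asg_eq s t : sval s = sval t -> s = t.
Proof.
by case: s t => [f fP] [g gP] /= e; case: g / e gP => gP; congr exist;
  exact: Prop_irrelevance.
Qed.

Lemma ext_refl s : ext s s. Proof. by []. Qed.

Lemma ext_dom s t i : ext s t -> sval s i <> None -> sval t i <> None.
Proof. by move=> st si; rewrite st. Qed.

Lemma ext_anti s t : ext s t -> ext t s -> s = t.
Proof.
move=> st ts; apply/asg_eq/funext => i.
have [si|si] := pselect (sval s i = None); last by rewrite st.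
have [ti|ti] := pselect (sval t i = None); first by rewrite si ti.
by rewrite ts.
Qed.

Lemma ext_trans s t r : ext r s -> ext s t -> ext r t.
Proof. by move=> rs st i ri; rewrite st ?rs. Qed.

Lemma ext_eq s t : ext s t -> (forall i, sval s i = None -> sval t i = None) -> s = t.
Proof.
by move=> st h; apply: ext_anti => // i ti; rewrite st // => si; apply: ti; exact: h.
Qed.

Lemma seg_lt s i j : sval s i <> None -> sval s j = None -> ~ le j i.
Proof. by move=> si sj ji; exact: (svalP s _ _ ji si). Qed.

Definition asg0 : asg := exist segment (fun=> None) (fun i j _ h => h).

Lemma asg0_ext t : ext asg0 t. Proof. by move=> i. Qed.

(** Restrictions of [t] are determined by the least index on which they are
undefined; the member of [A] that stops first is the least one. *)
Lemma asg_wo t (A : set asg) : (forall s, A s -> ext s t /\ s <> t) -> A !=set0 ->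
  exists2 r, A r & forall s, A s -> ext r s.
Proof.
move=> At [a Aa].
have [|i [s0 [As0 s0i ti]] im] :=
  le_wo (A := fun i => exists s, [/\ A s, sval s i = None & sval t i <> None]).
  have [ext_at ne] := At _ Aa; apply: contrapT => h; apply: ne.
  by apply: ext_eq => // i ai; apply: contrapT => ti; apply: h; exists i, a.
exists s0 => // s As j s0j; have [s0t _] := At _ As0; have [st _] := At _ As.
have sj : sval s j <> None.
  move=> sj; apply: (seg_lt s0j s0i); apply: im; exists s; split=> //.
  exact: ext_dom s0j.
by rewrite -(s0t j) // -(st j).
Qed.

Definition asg_tree : tree :=
  Tree ext_refl ext_anti ext_trans asg0_ext asg_wo.

Definition least_missing t i : Prop :=
  sval t i = None /\ forall j, sval t j = None -> le i j.

Lemma least_missing_exists t i : sval t i = None -> exists i0, least_missing t i0.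
Proof.
by move=> ti; have [|i0 t0 m] := le_wo (A := fun j => sval t j = None);
  [exists i | exists i0].
Qed.

Lemma least_missing_lt t i j : least_missing t i -> ~ le i j -> sval t j <> None.
Proof. by move=> [_ m] ij tj; apply: ij; exact: m. Qed.

Definition put t i (c : bool) : I -> option bool :=
  fun j => if `[< j = i >] then Some c else sval t j.

Lemma put_segment t i c : least_missing t i -> segment (put t i c).
Proof.
move=> lm j k kj; rewrite /put; case: asboolP => ji; case: asboolP => ki // tj.
  apply: (least_missing_lt lm) => ik; apply: ki; apply: le_anti => //.
  by rewrite -ji.
exact: (svalP t _ _ kj).
Qed.

Definition extend t i (lm : least_missing t i) c : asg :=
  exist segment (put t i c) (@put_segment t i c lm).

Section Extend.
Variables (t : asg) (i : I) (lm : least_missing t i).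

Lemma extend_at c : sval (extend lm c) i = Some c.
Proof. by rewrite /= /put asboolT. Qed.

Lemma extend_other c j : j <> i -> sval (extend lm c) j = sval t j.
Proof. by move=> ji; rewrite /= /put asboolF. Qed.

Lemma ext_extend c : ext t (extend lm c).
Proof.
by move=> j tj; rewrite extend_other // => ji; apply: tj; rewrite ji; case: lm.
Qed.

(** A proper extension of [t] is defined at the least index [i] missing from
[t], because its domain is a segment.  Hence the children of [t] are the two
assignments that add a value at [i]. *)
Lemma extend_least s : ext t s -> s <> t -> exists c, ext (extend lm c) s.
Proof.
move=> ts ne.
have : sval s i <> None.
  move=> si; apply: ne; apply/esym/ext_eq => // j tj; apply: contrapT => sj.
  by apply: (seg_lt sj si); apply: (proj2 lm).
case si : (sval s i) => [c|] // _; exists c => j.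
have [->|ji] := pselect (j = i); first by rewrite extend_at.
by rewrite extend_other // => tj; rewrite ts.
Qed.

Lemma extend_child c : @child asg_tree t (extend lm c).
Proof.
split; first split.
- exact: ext_extend.
- by move=> e; have := extend_at c; rewrite -e; case: lm => ->.
- move=> r [tr rt] [rx rne].
  have [c' h] := extend_least tr (nesym rt).
  apply: rne; apply: ext_anti => //.
  suff -> : c = c' by [].
  have r1 : sval r i = Some c' by rewrite h extend_at.
  have ci : sval (extend lm c) i = sval r i by apply: rx; rewrite r1.
  by move: ci; rewrite r1 extend_at => -[].
Qed.

Lemma childE s : @child asg_tree t s -> exists c, s = extend lm c.
Proof.
move=> [[ts ne] no]; have [c h] := extend_least ts (nesym ne).
exists c; apply: contrapT => sne; apply: (no (extend lm c)); last by split=> // /esym.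
by have [] := extend_child c.
Qed.

End Extend.

Lemma child_small (K : smallT) (t : asg) : regular_cardinal K ->
  ~ @leaf asg_tree t -> ksmall K {s : vertex asg_tree | @child asg_tree t s}.
Proof.
move=> rK nl.
have [i0 lm] : exists i, least_missing t i.
  have [s [ts ne]] : exists s, @tlt asg_tree t s.
    by apply: contrapT => h; apply: nl => s ts; apply: h; exists s.
  apply: contrapT => h; apply: ne; apply: ext_eq => // i ti.
  by have := least_missing_exists ti.
apply: (ksmall_inj (f := fun s : {s : vertex asg_tree | @child asg_tree t s} => sval (sval s) i0)).
  move=> [s cs] [s' cs'] /= e.
  suff e' : s = s' by case: s' / e' cs' {e} => cs'; congr exist; exact: Prop_irrelevance.
  move: e; have [c ->] := childE lm cs; have [c' ->] := childE lm cs'.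
  by rewrite !extend_at => -[->].
by apply: (ksmall_option rK); exact: ksmall_bool.
Qed.

Section Branch.
Variables (b : set (vertex asg_tree)) (bb : branch b).

(** Maximality of a branch, as a membership criterion. *)
Lemma branch_mem r : (forall s, b s -> ext s r \/ ext r s) -> b r.
Proof.
move=> cmp; have [cb mb] := bb.
apply: (mb (fun s => b s \/ s = r)); [|by left|by right].
move=> s s' [bs|->] [bs'|->]; [exact: cb|exact: cmp| |by left; exact: ext_refl].
by have [] := cmp _ bs'; [right|left].
Qed.

(** Otherwise the union of the branch, prolonged up to [i], would be comparable
to all its members without belonging to it. *)
Lemma branch_total i : exists2 t, b t & sval t i <> None.
Proof.
apply: contrapT => noi; have [cb _] := bb.
pose val k c := exists2 t : asg, b t & sval t k = Some c.
have val_fun k c c' : val k c -> val k c' -> c = c'.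
  move=> [t bt tk] [t' bt' tk'].
  suff : sval t k = sval t' k by rewrite tk tk' => -[].
  have [tt'|t't] := cb t t' bt bt'; last by rewrite t't ?tk'.
  by rewrite tt' ?tk.
(* The union of the branch, with value [true] at the missing indices up to [i]. *)
pose f k := match pselect (exists c, val k c) with
  | left h => Some (sval (cid h))
  | right _ => if `[< le k i >] then Some true else None end.
have f_val k c : val k c -> f k = Some c.
  move=> v; rewrite /f; case: pselect => [h|[]]; last by exists c.
  by congr Some; apply: val_fun (svalP (cid h)) v.
have fseg : segment f.
  move=> k l lk fk.
  have [[c [t bt tk]]|nv] := pselect (exists c, val k c).
    have tl : sval t l <> None by apply: (svalP t _ _ lk); rewrite tk.
    case tlE : (sval t l) tl => [c'|] // _.
    by rewrite (@f_val l c') //; exists t.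
  move: fk; rewrite {1}/f; case: pselect => //= _; case: asboolP => // ki _.
  by rewrite /f; case: pselect => // _; rewrite asboolT //; exact: le_trans ki.
have bf : b (exist segment f fseg).
  apply: branch_mem => s bs; left => k /=.
  by case sk : (sval s k) => [c|] // _; apply: f_val; exists s.
apply: noi; exists (exist segment f fseg) => //=.
rewrite /f; case: pselect => // _; rewrite asboolT //.
by have [] := le_total i i.
Qed.

(** Members of a branch are separated by their least missing index, which bounds
the size of a branch by that of [option I]. *)
Definition missing_index (t : asg) (o : option I) : Prop :=
  if o is Some i then least_missing t i else forall i, sval t i <> None.

Lemma missing_index_exists (t : asg) : exists o, missing_index t o.
Proof.
have [[i ti]|h] := pselect (exists i, sval t i = None).
  by have [i0] := least_missing_exists ti; exists (Some i0).
by exists None => i ti; apply: h; exists i.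
Qed.

Lemma missing_index_ext s t o : ext s t -> missing_index s o -> missing_index t o ->
  s = t.
Proof.
move=> st so to; apply: ext_eq => // i si; case: o so to => [i0|] /=.
  move=> so [ti0 _]; apply: contrapT => ti.
  by apply: (seg_lt ti ti0); apply: (proj2 so).
by move=> /(_ i).
Qed.

Lemma branch_small (K : smallT) : regular_cardinal K -> ksmall K I ->
  ksmall K {t : vertex asg_tree | b t}.
Proof.
move=> rK kI; have [cb _] := bb.
pose f (t : {t : vertex asg_tree | b t}) : option I :=
  sval (cid (missing_index_exists (sval t))).
have fP u : missing_index (sval u) (f u) by rewrite /f; case: cid.
apply: (ksmall_inj (f := f)) (ksmall_option rK kI) => t t' e.
have ft := fP t; have ft' := fP t'; rewrite -e in ft'.
suff e' : sval t = sval t'.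
  case: t t' e' {e ft ft'} => [t bt] [t' bt'] /= e'.
  by case: t' / e' bt' => bt'; congr exist; exact: Prop_irrelevance.
have [tt'|t't] := cb _ _ (svalP t) (svalP t').
  exact: missing_index_ext tt' ft ft'.
by apply/esym; exact: missing_index_ext t't ft' ft.
Qed.

Definition cut (t : asg) j : I -> option bool :=
  fun i => if `[< le j i >] then None else sval t i.

Lemma cut_segment t j : segment (cut t j).
Proof.
move=> i k ki; rewrite /cut; case: asboolP => // ji ti; case: asboolP => jk.
  by case: ji; exact: le_trans ki.
exact: (svalP t _ _ ki).
Qed.

(** If every [s] below [t] in the branch were undefined at [j], then the
restriction of [t] to the indices before [j] would belong to the branch and be
the immediate predecessor of [t] there. *)
Lemma limit_step_dom t j : limit_step b t -> sval t j <> None ->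
  exists s, [/\ b s, @tlt asg_tree s t & sval s j <> None].
Proof.
move=> [bt _ lim] tj; have [cb _] := bb; apply: contrapT => h.
have no s : b s -> @tlt asg_tree s t -> sval s j = None.
  by move=> bs st; apply: contrapT => sj; apply: h; exists s.
pose r : asg := exist segment (cut t j) (@cut_segment t j).
have rt : ext r t by move=> i /=; rewrite /cut; case: asboolP.
have below s : b s -> @tlt asg_tree s t -> ext s r.
  move=> bs st i si /=; rewrite /cut asboolF.
    by case: st => + _; apply.
  exact: seg_lt si (no _ bs st).
have br : b r.
  apply: branch_mem => s bs.
  have [st|ts] := cb s t bs bt; last by right; exact: ext_trans ts.
  have [->|ne] := pselect (s = t); first by right.
  by left; apply: below.
have jj : le j j by have [] := le_total j j.
have rj : sval r j = None by rewrite /= /cut asboolT.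
have [|q [bq [rq ne] qt]] := lim r br.
  by split=> // e; apply: tj; rewrite -e.
by apply: ne; apply: ext_anti => //; exact: below.
Qed.

End Branch.

End Assignments.

Section TransfiniteCover.
Variables (K : smallT) (rK : regular_cardinal K) (C : category).
Hypothesis limC : has_ksmall_limits K C.
Hypothesis uniC : has_stable_ksmall_unions K C.
Hypothesis copC : has_ksmall_disjoint_coproducts K C.
Hypothesis covC : has_transfinite_covers K C.

Local Notation two := (two rK limC copC).
Local Notation const := (const rK limC copC).

Variables (I : smallT) (kI : ksmall K I) (le : I -> I -> Prop).
Hypothesis le_total : forall i j, le i j \/ le j i.
Hypothesis le_anti : forall i j, le i j -> le j i -> i = j.
Hypothesis le_trans : forall i j k, le i j -> le j k -> le i k.
Hypothesis le_wo :
  forall A : set I, A !=set0 -> exists2 i, A i & forall j, A j -> le i j.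

Variables (z : C) (chi : I -> hom z two).

Local Notation T := (asg_tree le_wo).
Implicit Types s t : asg le.

(** [h] lands where the [chi i] take the values prescribed by [t]. *)
Definition obeys t u (h : hom u z) : Prop :=
  forall i c, sval t i = Some c -> chi i \c h = const c u.

Lemma obeys_comp t u v (h : hom u z) (k : hom v u) : obeys t h -> obeys t (h \c k).
Proof. by move=> o i c ti; rewrite compA (o i c) // const_comp. Qed.

Lemma obeys_ext s t u (h : hom u z) : ext s t -> obeys t h -> obeys s h.
Proof. by move=> st o i c si; apply: o; rewrite st si. Qed.

Lemma locus_exists t : exists (v : C) (n : hom v z),
  [/\ mono n, obeys t n & forall u (h : hom u z), obeys t h -> through n h].
Proof.
have [v [n [mn nE un _]]] := joint_equalizer_exists rK limC chi
  (fun i => if sval t i is Some c then const c z else chi i) kI.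
exists v, n; split=> // [i c ti|u h o].
  by rewrite nE ti const_comp.
apply: un => i; case ti : (sval t i) => [c|] //.
by rewrite const_comp; exact: o.
Qed.

Definition locus t : C := sval (cid (locus_exists t)).
Definition locus_in t : hom (locus t) z := sval (cid (svalP (cid (locus_exists t)))).

Lemma locusP t : [/\ mono (locus_in t), obeys t (locus_in t) &
  forall u (h : hom u z), obeys t h -> through (locus_in t) h].
Proof. exact: svalP (cid (svalP (cid (locus_exists t)))). Qed.

Lemma locus_through s t : ext t s -> through (locus_in t) (locus_in s).
Proof.
move=> ts; have [_ _ u] := locusP t; have [_ o _] := locusP s.
by apply: u; exact: obeys_ext ts o.
Qed.

Definition locus_map s t (ts : ext t s) : hom (locus s) (locus t) :=
  sval (cid (locus_through ts)).

Lemma locus_mapE s t (ts : ext t s) : locus_in t \c locus_map ts = locus_in s.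
Proof. by rewrite /locus_map; case: cid. Qed.

Definition locus_cotree : cotree T C.
Proof.
refine (@Functor (opcat (tree_cat T)) C locus (fun s t ts => @locus_map s t ts) _ _).
- by move=> t; have [m _ _] := locusP t; apply: m; rewrite locus_mapE compm1.
- move=> r s t st rs; have [m _ _] := locusP t; apply: m.
  by rewrite compA !locus_mapE.
Defined.

(** The children of [t] split its locus according to the value of [chi i], for the
least missing index [i]. *)
Lemma locus_covering : locally_covering K locus_cotree.
Proof.
move=> t nl; split; first exact: (child_small le_anti rK nl).
have [i lm] : exists i, least_missing t i.
  apply: contrapT => h; apply: nl => s [ts]; apply; apply: ext_eq => // i ti.
  by case: h; exact: (least_missing_exists le_wo ti).
move=> s m mm thr; apply: mono_section_iso => //.
apply: (two_cover uniC (chi := chi i \c locus_in t)) => // c u j e.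
pose t' := extend le_anti lm c.
have ct' : @child T t t' by exact: extend_child.
have [_ ot _] := locusP t; have [_ _ univ] := locusP t'.
have [|k kE] := univ u (locus_in t \c j).
  move=> i' c'; have [->|ne] := pselect (i' = i).
    by rewrite extend_at => -[<-]; rewrite compA.
  by rewrite extend_other // => /ot; rewrite !compA => ->; rewrite const_comp.
have [g gE] := thr (exist _ t' ct'); exists (g \c k).
have [mt _ _] := locusP t; apply: mt.
by rewrite (compA m) gE compA /cotree_map /= locus_mapE.
Qed.

(** A cone over the loci below [t] obeys every condition of [t], since by
[limit_step_dom] each of them already occurs below [t]. *)
Lemma locus_continuous (b : set (vertex T)) : branch b ->
  continuous_branch locus_cotree b.
Proof.
move=> bb t lim; have [bt [s0 bs0 s0t] _] := lim; split.
  move=> i j u; have [m _ _] := locusP (sval j); apply: m.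
  by rewrite compA !locus_mapE.
move=> w q cq; have b0 : b root by exact: branch_root.
have t0 : @tlt T root t.
  split; first exact: root_le.
  move=> e; apply: (proj2 s0t); apply: (@ext_anti _ le).
    by case: s0t.
  by rewrite -[in X in ext X](e); exact: asg0_ext.
pose r0 : {s | b s /\ tlt s t} := exist _ root (conj b0 t0).
have q0 (s : {s | b s /\ tlt s t}) : locus_in (asg0 le) \c q r0 = locus_in (sval s) \c q s.
  rewrite -(cq s r0 (root_le _)) compA; congr (_ \c _); exact: locus_mapE.
have [mt ot univ] := locusP t.
have [|h hE] := univ w (locus_in (asg0 le) \c q r0).
  move=> i c ti; have [|s [bs st si]] :=
    limit_step_dom le_total le_trans bb lim (j := i); first by rewrite ti.
  rewrite (q0 (exist _ s (conj bs st))); have [_ os _] := locusP s.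
  by apply: obeys_comp os _ _ _; rewrite -ti; case: st => + _ => ->.
exists h; split.
  move=> s /=; have [m _ _] := locusP (sval s); apply: m.
  by rewrite compA locus_mapE hE (q0 s).
move=> h' h'E; apply: mt; rewrite hE -(h'E r0) compA; congr (_ \c _).
exact: locus_mapE.
Qed.

Lemma subcat_small (b : set (vertex T)) : ksmall K {t | b t} ->
  ksmall_category K (@full_subcat (opcat (tree_cat T)) b).
Proof.
move=> kb; exists {s : {t | b t} & {t : {t | b t} & ext (sval t) (sval s)}}, id.
split; first by exists id.
apply: (ksmall_sig rK) => // s; apply: (ksmall_sig rK) => // t.
by apply: (ksmall_subsingleton rK) => *; exact: Prop_irrelevance.
Qed.

Lemma constant_cover_wo v (n : hom v z) : mono n ->
  (forall u (j : hom u z), (forall i, exists b, chi i \c j = const b u) -> through n j) ->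
  through n (idm z).
Proof.
move=> mn thr.
have small (b : {b : set (vertex T) | branch b}) : ksmall K {t | sval b t}.
  exact (branch_small (svalP b) rK kI).
have lim (b : {b : set (vertex T) | branch b}) :=
  cid (limC (restrict locus_cotree (sval b)) (subcat_small (small b))).
pose L b := sval (lim b); pose p b := sval (cid (svalP (lim b))).
have pP b : is_limit (p b) := svalP (cid (svalP (lim b))).
have [m0 o0 u0] := locusP (asg0 le).
have [P [q1 [q2 pb]]] := pullback_exists rK limC n (locus_in (asg0 le)).
have mq := pullback_mono pb mn.
have [r [qr _]] : iso q2.
  apply: (covC locus_covering _ pP mq) => [b bb|b].
    by split; [exact: (small (exist _ b bb)) | exact: locus_continuous].
  set e := p b _; have [cp _] := pP b.
  have [|k kE] := thr _ (locus_in (asg0 le) \c e).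
    move=> i; have [t' bt'] := branch_total le_total le_trans (svalP b) i.
    case t'i : (sval t' i) => [c|] // _; exists c.
    have <- : locus_in t' \c p b (exist _ t' bt') = locus_in (asg0 le) \c e.
      rewrite /e -(cp (exist _ t' bt') (exist _ root (branch_root (svalP b)))
                      (root_le t')) compA; congr (_ \c _).
      exact: (esym (locus_mapE _)).
    by have [_ o _] := locusP t'; apply: obeys_comp o _ _ t'i.
  by have [h [[_ hE] _]] := proj2 pb _ _ _ kE; exists h.
have [|k kE] := u0 z (idm z); first by move=> i c.
exists (q1 \c r \c k); rewrite -kE !compA (proj1 pb) -(compA _ q2) qr compm1 //.
Qed.

End TransfiniteCover.

(** An arbitrary kappa-small family of truth values on [z] becomes constant on
the members of a cover of [z], however many members this cover has.  This
infinitary distributivity is what makes complete ultrafilters on [F two] give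
coherent functors. *)
Lemma constant_cover (K : smallT) (rK : regular_cardinal K) (C : category)
    (limC : has_ksmall_limits K C) (copC : has_ksmall_disjoint_coproducts K C)
    (I : smallT) (z t : C) (chi : I -> hom z (two rK limC copC)) (n : hom t z) :
  has_stable_ksmall_unions K C -> has_transfinite_covers K C -> ksmall K I ->
  mono n ->
  (forall s (j : hom s z),
     (forall i, exists b, chi i \c j = const rK limC copC b s) -> through n j) ->
  through n (idm z).
Proof.
move=> uniC covC kI; have [le [tot anti tr wo]] := well_order_exists I.
exact: (constant_cover_wo uniC covC kI tot anti tr wo).
Qed.

(** * Effective epimorphisms of sets *)

(** The characteristic function of the image and the constant function [true]
agree after composition with [f], so they are equal. *)
Lemma SET_effective_surj (X Y : SET) (f : hom X Y) (y : Y) :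
  effective_epi f -> exists x, f x = y.
Proof.
move=> [R [p [q [_ [_ u]]]]].
have [|h [_ hu]] := u (bool : SET) (fun=> true); first by [].
have e1 := hu (fun y' => `[< exists x, f x = y' >]).
rewrite (hu (fun=> true)) // in e1.
apply/asboolP; rewrite -(congr1 (@^~ y) (e1 _)) //.
by apply/funext => x; apply/asboolP; exists x.
Qed.

Lemma SET_surj_effective (X Y : SET) (f : hom X Y) :
  (forall y, exists x, f x = y) -> effective_epi f.
Proof.
move=> sf; pose R : SET := {xx : X * X | f xx.1 = f xx.2}.
exists R, (fun r => (sval r).1), (fun r => (sval r).2); split; split.
- by apply/funext => -[].
- move=> Z p q pq; have e t : f (p t) = f (q t) := congr1 (@^~ t) pq.
  exists (fun t => exist _ (p t, q t) (e t)); split=> // h [hp hq].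
  apply/funext => t; move: (congr1 (@^~ t) hp) (congr1 (@^~ t) hq) => /=.
  case: (h t) => -[x x'] /= fx xE x'E; move: (e t); rewrite -xE -x'E => fx'.
  by congr exist; exact: Prop_irrelevance.
- by apply/funext => -[].
- move=> Z g gE; pose c y := sval (cid (sf y)).
  have cE y : f (c y) = y := svalP (cid (sf y)).
  have gf x x' : f x = f x' -> g x = g x'.
    by move=> e; have := congr1 (@^~ (exist _ (x, x') e)) gE.
  exists (fun y => g (c y)); split.
    by apply/funext => x; apply: gf; rewrite cE.
  by move=> h <-; apply/funext => y /=; rewrite cE.
Qed.

Lemma fmapME (C : category) (F : functor C SET) (x y z : C) (g : hom y z)
  (f : hom x y) (e : F x) : fmap F (g \c f) e = fmap F g (fmap F f e).
Proof. by rewrite fmapM. Qed.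

Lemma fmap1E (C : category) (F : functor C SET) (x : C) (e : F x) :
  fmap F (idm x) e = e.
Proof. by rewrite fmap1. Qed.

(** * Elements of a limit-preserving functor *)

Section Elements.
Variables (K : smallT) (rK : regular_cardinal K) (C : category).
Hypothesis limC : has_ksmall_limits K C.
Variables (F : functor C SET) (lexF : preserves_ksmall_limits K F).

(** Together with [equalize_at], this says that the category of elements of [F]
is kappa-cofiltered.  The hypotheses on [F] are only used through these two
facts and the surjectivity of [F] on effective epimorphisms. *)
Lemma common_source (T : smallT) (w : T -> C) (d : forall t, F (w t)) : ksmall K T ->
  exists (v : C) (e : F v) (p : forall t, hom v (w t)), forall t, fmap F (p t) e = d t.
Proof.
move=> kT; have [v [p [_ h]]] := product_exists rK limC w kT.
by have [e eE] := h F lexF d; exists v, e, p.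
Qed.

Lemma equalize_at (I : smallT) (w : C) (d : F w) (z : I -> C)
    (f g : forall i, hom w (z i)) : ksmall K I ->
  (forall i, fmap F (f i) d = fmap F (g i) d) ->
  exists (v : C) (e : F v) (n : hom v w),
    fmap F n e = d /\ forall i, f i \c n = g i \c n.
Proof.
move=> kI dE; have [v [n [_ nE _ h]]] := joint_equalizer_exists rK limC f g kI.
by have [e eE] := h F lexF d dE; exists v, e, n.
Qed.

Lemma common_source_over (T : smallT) (w : T -> C) (d : forall t, F (w t)) (z : C)
    (c : F z) (u : forall t, hom (w t) z) : ksmall K T ->
  (forall t, fmap F (u t) (d t) = c) ->
  exists (v : C) (e : F v) (p : forall t, hom v (w t)) (q : hom v z),
  [/\ forall t, fmap F (p t) e = d t, fmap F q e = c & forall t, u t \c p t = q].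
Proof.
move=> kT uE.
pose w' (o : option T) : C := if o is Some t then w t else z.
pose d' (o : option T) : F (w' o) := if o is Some t return F (w' o) then d t else c.
have [v [e [p pE]]] := common_source d' (ksmall_option rK kT).
have pS t : fmap F (p (Some t)) e = d t := pE (Some t).
have pN : fmap F (p None) e = c := pE None.
have [|v' [e' [n [nE eqn]]]] := @equalize_at T v e (fun=> z)
  (fun t => u t \c p (Some t)) (fun=> p None) kT.
  by move=> t; rewrite fmapME pS uE pN.
exists v', e', (fun t => p (Some t) \c n), (p None \c n); split=> [t||t].
- by rewrite fmapME nE pS.
- by rewrite fmapME nE pN.
- by rewrite compA eqn.
Qed.

Lemma pullback_at (x y z : C) (f : hom x z) (g : hom y z) (a : F x) (b : F y) :
  fmap F f a = fmap F g b ->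
  exists (v : C) (e : F v) (p : hom v x) (q : hom v y),
  [/\ fmap F p e = a, fmap F q e = b & f \c p = g \c q].
Proof.
move=> fg; have [v [e [p pE]]] := @common_source bool
  (fun b => if b then x else y)
  (fun s => if s return F (if s then x else y) then a else b) (ksmall_bool rK).
have pT : fmap F (p true) e = a := pE true.
have pF : fmap F (p false) e = b := pE false.
have [|v' [e' [n [nE eqn]]]] := @equalize_at unit v e (fun=> z)
  (fun=> f \c p true) (fun=> g \c p false) (ksmall_unit rK).
  by move=> _; rewrite !fmapME pT pF.
exists v', e', (p true \c n), (p false \c n); split; rewrite ?fmapME ?nE //.
by rewrite !compA (eqn tt).
Qed.

Lemma pair_at (x y : C) (a : F x) (b : F y) :
  exists (v : C) (e : F v) (p : hom v x) (q : hom v y),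
    fmap F p e = a /\ fmap F q e = b.
Proof.
have [v [e [p pE]]] := @common_source bool
  (fun b => if b then x else y)
  (fun s => if s return F (if s then x else y) then a else b) (ksmall_bool rK).
by exists v, e, (p true), (p false); split; [exact: (pE true)|exact: (pE false)].
Qed.

Lemma lex_mono (x y : C) (m : hom x y) : mono m -> injective (fmap F m).
Proof.
by move=> mm a b /pullback_at[v [e [p [q [<- <- /mm ->]]]]].
Qed.

End Elements.

(** * Consistent valuations of propositions *)

Section Valuation.
Variables (K : smallT) (rK : regular_cardinal K) (C : category).
Hypothesis limC : has_ksmall_limits K C.
Hypothesis imC : has_stable_image_factorizations C.
Hypothesis uniC : has_stable_ksmall_unions K C.
Hypothesis copC : has_ksmall_disjoint_coproducts K C.
Hypothesis covC : has_transfinite_covers K C.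
Variables (F : functor C SET) (lexF : preserves_ksmall_limits K F).

Local Notation two := (two rK limC copC).
Local Notation const := (const rK limC copC).

(** On the stage [j], each [chi i] is constant, with the value that [s] gives to
the proposition [F (chi i) e]. *)
Definition matches (s : F two -> bool) z (e : F z) (I : smallT) (chi : I -> hom z two)
    v (j : hom v z) : Prop :=
  forall i, chi i \c j = const (s (fmap F (chi i) e)) v.

Section Avoiding.
Variables (x0 y0 : C) (m : hom x0 y0) (a : F y0).

(** The consistency requirement on a valuation: it is realized, by every small
family of propositions at an element over [a], on some stage that [m] does not
contain.  Taking [chi] to express a Boolean identity shows that such an [s] is
the characteristic function of a complete ultrafilter. *)
Definition avoiding (s : F two -> bool) : Prop :=
  forall z (q : hom z y0) (e : F z) (I : smallT) (chi : I -> hom z two),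
    ksmall K I -> fmap F q e = a ->
    exists v (j : hom v z), matches s e chi j /\ ~ through m (q \c j).

Hypothesis mm : mono m.
Hypothesis am : forall b, fmap F m b <> a.

(** By [constant_cover], if all the stages on which the [chi i] are constant were
carried into [m], then so would be all of [z], and [a] would be in the image of
[F m].  Two indices that define the same proposition at [e] must receive the same
value; this is arranged by first passing to the part of [z] where the two maps
agree, which still contains [e]. *)
Lemma local_valuation z (q : hom z y0) (e : F z) (I : smallT) (chi : I -> hom z two) :
  ksmall K I -> fmap F q e = a ->
  exists s v (j : hom v z), matches s e chi j /\ ~ through m (q \c j).
Proof.
move=> kI qe; apply: contrapT => none.
(* The pairs of indices that define the same proposition at [e]. *)
pose E := {ii : I * I | fmap F (chi ii.1) e = fmap F (chi ii.2) e}.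
have kE : ksmall K E.
  apply: (ksmall_inj (f := @sval _ _)) (ksmall_prod rK kI kI).
  move=> [p pE] [p' p'E] /= pp'; case: p' / pp' p'E => p'E.
  by congr exist; exact: Prop_irrelevance.
have [|z' [e' [n [nE eqn]]]] := @equalize_at _ rK _ limC _ lexF E z e (fun=> two)
  (fun ii => chi (sval ii).1) (fun ii => chi (sval ii).2) kE.
  by case.
have [P [p1 [p2 pb]]] := pullback_exists rK limC m (q \c n).
have [|r rE] := constant_cover (chi := fun i => chi i \c n) uniC covC kI
  (pullback_mono pb mm).
  move=> v j cst.
  suff [k kE'] : through m (q \c n \c j).
    by have [h [[_ hj] _]] := proj2 pb _ _ _ kE'; exists h.
  have [iv|nv] := pselect (initial v).
    by have [k] := initial_arrow x0 iv; exists k; exact: initial_uniq.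
  have [b bE] := choice cst.
  apply: contrapT => nthr; apply: none.
  pose s c := `[< exists2 i, fmap F (chi i) e = c & b i >].
  have sE i : s (fmap F (chi i) e) = b i.
    case bi : (b i); first by apply/asboolP; exists i.
    apply/asboolP => -[i' eii bi']; apply: nv.
    have := eqn (exist _ (i', i) eii) => /= /(congr1 (fun f => f \c j)).
    by rewrite !bE bi bi'; exact: const_initial.
  by exists s, v, (n \c j); split=> [i|]; rewrite compA // bE sE.
apply: (am (b := fmap F (p1 \c r) e')).
by rewrite -fmapME compA (proj1 pb) -compA rE compm1 fmapME nE.
Qed.

(** The requests that make up [avoiding], as data indexing a filter base. *)
Record condition := Condition {
  cob : C; cmap : hom cob y0; celt : F cob;
  cidx : smallT; cchi : cidx -> hom cob two;
  csmall : ksmall K cidx; celtE : fmap F cmap celt = a }.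

Definition satisfies (c : condition) (s : F two -> bool) : Prop :=
  exists v (j : hom v (cob c)),
    matches s (celt c) (@cchi c) j /\ ~ through m (cmap c \c j).

Definition cond_filter : set_system (F two -> bool) :=
  fun P => exists c, satisfies c `<=` P.

(** Small families of conditions have a common refinement, over the product of
their objects fibred over [y0]. *)
Lemma cond_filter_kcomplete : kcomplete K cond_filter.
Proof.
move=> T A kT /choice[c cA].
have [v [e [p [q [pE qE up]]]]] := common_source_over rK limC lexF kT (fun t => celtE (c t)).
pose chi (ti : {t : T & cidx (c t)}) := cchi (projT2 ti) \c p (projT1 ti).
have kS : ksmall K {t : T & cidx (c t)}.
  by apply: (ksmall_sig rK) => // t; exact: csmall.
exists (Condition chi kS qE) => s [v' [j [/= sj nj]]] t; apply: cA.
exists v', (p t \c j); split; last by rewrite compA up.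
move=> i; have := sj (existT _ t i); rewrite /chi /= compA => ->.
by rewrite fmapME pE.
Qed.

Lemma cond_filter_proper : ProperFilter cond_filter.
Proof.
have FS (P Q : set (F two -> bool)) : P `<=` Q -> cond_filter P -> cond_filter Q.
  by move=> PQ [c cP]; exists c => s /cP/PQ.
split; last split=> //.
- move=> [c c0].
  by have [s [v [j h]]] := local_valuation (cchi (c:=c)) (csmall c) (celtE c);
    apply: (c0 s); exists v, j.
- exists (@Condition y0 (idm y0) a void (fun i => match i with end)
    (ksmall_empty rK (of_void _)) (fmap1E a)) => //.
- move=> P Q cP cQ.
  have := @cond_filter_kcomplete bool (fun b => if b then P else Q) (ksmall_bool rK).
  move=> h; apply: FS (h _); last by case.
  by move=> s hs; split; [exact: (hs true)|exact: (hs false)].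
Qed.

(** The valuation sends a proposition to the truth value that almost all
valuations give to it.  By completeness, almost all valuations agree with it on
any small family of propositions at once. *)
Lemma avoiding_exists : compact_cardinal K -> exists s, avoiding s.
Proof.
move=> [_ cK].
have [G [UG kG FG]] := cK _ _ cond_filter_proper cond_filter_kcomplete.
have PG := @ultra_proper _ _ UG.
exists (fun c => `[< G [set s : F two -> bool | s c] >]) => z q e I chi kI qe.
set s := (X in matches X).
have Gs c : G [set s' : F two -> bool | s' c = s c].
  rewrite /s; case: asboolP => // nG.
  have [//|] := in_ultra_setVsetC [set s' : F two -> bool | s' c] UG.
  by apply: filterS => s' /= /negP/negbTE.
have GI := kG _ (fun i => [set s' : F two -> bool |
  s' (fmap F (chi i) e) = s (fmap F (chi i) e)]) kI (fun i => Gs _).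
have GD : G (satisfies (Condition chi kI qe)) by apply: FG; exists (Condition chi kI qe).
have [s' [/= sE [v [j [sj nj]]]]] := filter_ex (filterI GI GD).
by exists v, j; split=> // i; rewrite sj sE.
Qed.

End Avoiding.

(** * Forcing *)

Section Forcing.
Variables (s : F two -> bool) (x0 y0 : C) (m : hom x0 y0) (a : F y0).
Hypothesis sm : avoiding m a s.
Hypothesis epiF : preserves_effective_epis F.

(** [R] is a property of stages of [z], usually closed under restriction.  The
passage to some [e] over [d] allows propositions that are definable from [d] only
together with further elements, which makes [forces] stable under pullback. *)
Definition forces z (d : F z) (R : forall v, hom v z -> Prop) : Prop :=
  exists w (e : F w) (p : hom w z) (I : smallT) (chi : I -> hom w two),
    [/\ ksmall K I, fmap F p e = d &
        forall v (j : hom v w), matches s e chi j -> R v (p \c j)].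

Lemma forces_sub z (d : F z) (R R' : forall v, hom v z -> Prop) :
  (forall v (j : hom v z), R v j -> R' v j) -> forces d R -> forces d R'.
Proof.
move=> RR' [w [e [p [I [chi [kI pe h]]]]]]; exists w, e, p, I, chi.
by split=> // v j /h/RR'.
Qed.

Lemma forces_bigcap (T : smallT) z (d : F z) (R : T -> forall v, hom v z -> Prop) :
  ksmall K T -> (forall t, forces d (R t)) -> forces d (fun v j => forall t, R t v j).
Proof.
move=> kT dR.
have /all_tag[w /all_tag[e /all_tag[p /all_tag[I /all_tag[chi h]]]]] : forall t,
    {w & {e : F w & {p : hom w z & {I : smallT & {chi : I -> hom w two &
      [/\ ksmall K I, fmap F p e = d &
        forall v (j : hom v w), matches s e chi j -> R t v (p \c j)]}}}}}.
  move=> t; have [w /cid[e /cid[p /cid[I /cid[chi h]]]]] := cid (dR t).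
  by exists w, e, p, I, chi.
have [v [f [q [r [qf rf pq]]]]] := common_source_over rK limC lexF kT
  (fun t => let: And3 _ pe _ := h t in pe).
exists v, f, r, {t : T & I t}, (fun ti => chi (projT1 ti) (projT2 ti) \c q (projT1 ti)).
split=> // [|v' j mj t].
  by apply: (ksmall_sig rK) => // t; have [] := h t.
have [_ _ ht] := h t; rewrite -(pq t) -compA; apply: ht => i.
have := mj (existT _ t i); rewrite /= compA => ->.
by rewrite fmapME qf.
Qed.

Lemma forces_true z (d : F z) (R : forall v, hom v z -> Prop) :
  (forall v (j : hom v z), R v j) -> forces d R.
Proof.
move=> h; exists z, d, (idm z), void, (fun i : void => match i with end); split=> //.
- exact: ksmall_empty (of_void _).
- exact: fmap1E.
Qed.

Lemma forces_and z (d : F z) (R R' : forall v, hom v z -> Prop) :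
  forces d R -> forces d R' -> forces d (fun v j => R v j /\ R' v j).
Proof.
move=> dR dR'.
have := @forces_bigcap bool z d (fun b => if b then R else R') (ksmall_bool rK).
move=> h; apply: forces_sub (h _); last by case.
by move=> v j Rj; split; [exact: (Rj true)|exact: (Rj false)].
Qed.

Lemma forces_pull w z (u : hom w z) (d : F w) (R : forall v, hom v z -> Prop) :
  forces (fmap F u d) R -> forces d (fun v j => R v (u \c j)).
Proof.
move=> [w1 [e1 [p1 [I [chi [kI /esym pe h]]]]]].
have [v [e [p [q [pe' qe pq]]]]] := pullback_at rK limC lexF pe.
exists v, e, p, I, (fun i => chi i \c q); split=> // v' j mj.
rewrite compA pq -compA; apply: h => i.
by rewrite compA mj fmapME qe.
Qed.

Lemma forces_push w z (u : hom w z) (d : F w) (R : forall v, hom v z -> Prop) :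
  forces d (fun v j => R v (u \c j)) -> forces (fmap F u d) R.
Proof.
move=> [w1 [e1 [p1 [I [chi [kI pe h]]]]]]; exists w1, e1, (u \c p1), I, chi.
split=> // [|v j /h]; first by rewrite fmapME pe.
by rewrite compA.
Qed.

(** All uses of the consistency of [s] go through this lemma: what is forced does
happen on some stage. *)
Lemma forces_avoid z (d : F z) (q : hom z y0) R : fmap F q d = a -> forces d R ->
  exists v (j : hom v z), R v j /\ ~ through m (q \c j).
Proof.
move=> qd [w [e [p [I [chi [kI pe h]]]]]].
have [|v [j [mj nj]]] := sm (q := q \c p) (e := e) chi kI.
  by rewrite fmapME pe.
by exists v, (p \c j); split; [exact: h | rewrite compA].
Qed.

(** An initial stage is contained in [m]; to apply [forces_avoid], the element
[d] is paired with [a]. *)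
Lemma forces_noninitial z (d : F z) R : forces d R ->
  exists v (j : hom v z), R v j /\ ~ initial v.
Proof.
move=> dR; have [v [e [p [q [pe qe]]]]] := pair_at rK limC lexF d a.
have [|v' [j [Rj nj]]] := forces_avoid (R := fun v j => R v (p \c j)) qe.
  by apply: forces_pull; rewrite pe.
exists v', (p \c j); split=> // iv; apply: nj.
by have [k] := initial_arrow x0 iv; exists k; exact: initial_uniq.
Qed.

Lemma forces_matches z (d : F z) (I : smallT) (chi : I -> hom z two) : ksmall K I ->
  forces d (fun v j => matches s d chi j).
Proof.
move=> kI; exists z, d, (idm z), I, chi; split=> //; first exact: fmap1E.
by move=> v j; rewrite comp1m.
Qed.

Lemma forces_value z (d : F z) (chi : hom z two) :
  forces d (fun v j => chi \c j = const (s (fmap F chi d)) v).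
Proof.
have := forces_matches d (fun=> chi) (ksmall_unit rK).
by apply: forces_sub => v j /(_ tt).
Qed.

(** If every summand were rejected, a noninitial stage would miss all of them. *)
Lemma forces_inj (I : smallT) (B : I -> C) (kI : ksmall K I) (d : F (cop copC B kI)) :
  exists i, forces d (fun v j => through (inj copC B kI i) j).
Proof.
pose chi := classifier rK limC copC B kI.
have [v [j [mj nv]]] := forces_noninitial (forces_matches d chi kI).
have [[i si]|none] := pselect (exists i, s (fmap F (chi i) d) = true).
  exists i; apply: forces_sub (forces_value d (chi i)) => v' j'; rewrite si.
  exact: classifier_through.
case: nv; apply: (classifier_initial uniC (g := j)) => i; rewrite mj.
by case si : s => //; case: none; exists i.
Qed.

(** Let [w'] be the part of [w1] on which the [chi i] have their prescribed values;
there a map to [x] is available.  The coproduct of [w'] and of the parts on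
which one [chi i] has the opposite value covers [w1], so [e1] lifts to it, and
on the coproduct the map to [x] extends to a map to [x + 1].  The lifted element
lies in the summand [w'], since the others contradict the values prescribed. *)
Lemma forces_extend z (d : F z) (R : forall v, hom v z -> Prop) x
    (Q : forall v, hom v z -> hom v x -> Prop) :
  (forall v v' (g : hom v z) (h : hom v x) (k : hom v' v),
     Q v g h -> Q v' (g \c k) (h \c k)) ->
  (forall v (g : hom v z), R v g -> exists h, Q v g h) ->
  forces d R ->
  exists w (e : F w) (p : hom w z) (r : hom w (plus rK limC copC x)),
    fmap F p e = d /\
    forces e (fun v j => exists h, r \c j = inl rK limC copC x \c h /\ Q v (p \c j) h).
Proof.
move=> Qcomp RQ [w1 [e1 [p1 [I [chi [kI pe h1]]]]]].
pose val i := s (fmap F (chi i) e1).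
have [w' [k [_ kE ku _]]] := joint_equalizer_exists rK limC chi (fun i => const (val i) w1) kI.
have [|h Qh] := RQ _ (p1 \c k).
  by apply: h1 => i; rewrite kE const_comp.
have neg i := joint_equalizer_exists rK limC (fun _ : unit => chi i)
  (fun=> const (~~ val i) w1) (ksmall_unit rK).
pose N i := sval (cid (neg i)); pose n i : hom (N i) w1 := sval (cid (svalP (cid (neg i)))).
have nE i : chi i \c n i = const (~~ val i) (N i).
  have [_ e _ _] := svalP (cid (svalP (cid (neg i)))).
  by rewrite /n e ?const_comp.
have nu i v (j : hom v w1) : chi i \c j = const (~~ val i) v -> through (n i) j.
  have [_ _ u _] := svalP (cid (svalP (cid (neg i)))) => e.
  by apply: u => _; rewrite const_comp.
pose B (o : option I) : C := if o is Some i then N i else w'.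
have kO := ksmall_option rK kI.
pose beta : hom (cop copC B kO) w1 :=
  copair copC kO (fun o => if o is Some i return hom (B o) w1 then n i else k).
have bN : beta \c inj copC B kO None = k by rewrite /beta copairE.
have bS i : beta \c inj copC B kO (Some i) = n i by rewrite /beta copairE.
have eb : effective_epi beta.
  apply: extremal_effective => // t mt mmt [l lE].
  apply: (constant_cover uniC covC kI mmt (chi := chi)) => v j cst.
  suff [o [g gE]] : exists o, through (beta \c inj copC B kO o) j.
    by exists (l \c inj copC B kO o \c g); rewrite !compA lE.
  have [[i ci]|none] := pselect (exists i, chi i \c j = const (~~ val i) v).
    by exists (Some i); rewrite bS; exact: nu.
  exists None; rewrite bN; apply: ku => i; rewrite const_comp.
  have [c cE] := cst i; have [<- //|ne] := pselect (c = val i).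
  case: none; exists i; rewrite cE; suff -> : c = ~~ val i by [].
  by case: c (val i) ne {cE} => -[].
have [e eE] := SET_effective_surj e1 (epiF eb).
pose r : hom (cop copC B kO) (plus rK limC copC x) :=
  copair copC kO (fun o => if o is Some i return hom (B o) (plus rK limC copC x)
    then inr rK limC copC x \c bang rK limC (N i) else inl rK limC copC x \c h).
exists _, e, (p1 \c beta), r; split; first by rewrite fmapME eE.
have [o eo] := forces_inj e; case: o eo => [i|] eo.
  have eM : forces e (fun v j => chi i \c (beta \c j) = const (val i) v).
    by apply: (forces_pull (R := fun v j => chi i \c j = const (val i) v));
      rewrite eE; exact: forces_value.
  have [v [j [[[g gj] cj] []]]] := forces_noninitial (forces_and eo eM).
  move: cj; rewrite -gj (compA beta) bS compA nE const_comp => /esym.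
  exact: const_initial.
apply: forces_sub eo => v _ [g <-]; exists (h \c g); split.
  by rewrite !compA /r copairE.
by rewrite -(compA p1) (compA beta) bN compA; exact: Qcomp.
Qed.

End Forcing.

End Valuation.

(** * The localized functor *)

Section Model.
Variables (K : smallT) (rK : regular_cardinal K) (C : category).
Hypothesis limC : has_ksmall_limits K C.
Hypothesis imC : has_stable_image_factorizations C.
Hypothesis uniC : has_stable_ksmall_unions K C.
Hypothesis copC : has_ksmall_disjoint_coproducts K C.
Hypothesis covC : has_transfinite_covers K C.
Variables (F : functor C SET) (lexF : preserves_ksmall_limits K F).
Hypothesis epiF : preserves_effective_epis F.
Variables (s : F (two rK limC copC) -> bool) (x0 y0 : C) (m : hom x0 y0) (a : F y0).
Hypothesis sm : avoiding m a s.

Local Notation plus := (plus rK limC copC).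
Local Notation inl := (inl rK limC copC).
Local Notation inr := (inr rK limC copC).
Local Notation plus_map := (plus_map rK limC copC).
Local Notation forces := (forces s).

(** An element of [F (x + 1)] is a partially defined element of [F x]. *)
Section Agreement.
Variable x : C.
Implicit Types c : F (plus x).

Definition defined c : Prop := forces c (fun v j => through (inl x) j).

Definition agree c c' : Prop := exists w (e : F w) (u u' : hom w (plus x)),
  [/\ fmap F u e = c, fmap F u' e = c' & forces e (fun v j => u \c j = u' \c j)].

Lemma agree_refl c : agree c c.
Proof.
exists (plus x), c, (idm _), (idm _); split; rewrite ?fmap1E //.
exact: forces_true.
Qed.

Lemma agree_sym c c' : agree c c' -> agree c' c.
Proof.
move=> [w [e [u [u' [uE u'E h]]]]]; exists w, e, u', u; split=> //.
by apply: forces_sub h.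
Qed.

(** Agreement is witnessed on some object, and can be tested on any other. *)
Lemma agree_on c c' w (e : F w) (u u' : hom w (plus x)) :
  fmap F u e = c -> fmap F u' e = c' -> agree c c' ->
  forces e (fun v j => u \c j = u' \c j).
Proof.
move=> uE u'E [w1 [e1 [u1 [u1' [u1E u1'E h]]]]].
have [v [f [p [q [pf qf]]]]] := pair_at rK limC lexF e e1.
have [|v' [f' [n [nf eqn]]]] := equalize_at rK limC lexF (d := f) (z := fun=> plus x)
  (f := fun b : bool => if b then u \c p else u' \c p)
  (g := fun b : bool => if b then u1 \c q else u1' \c q) (ksmall_bool rK).
  by case; rewrite !fmapME pf qf ?uE ?u'E ?u1E ?u1'E.
have pfn : fmap F (p \c n) f' = e by rewrite fmapME nf.
rewrite -pfn; apply: forces_push.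
have h' : forces f' (fun v j => u1 \c (q \c n \c j) = u1' \c (q \c n \c j)).
  apply: (forces_pull lexF (R := fun v j => u1 \c j = u1' \c j)).
  by rewrite fmapME nf qf.
apply: forces_sub h' => v'' j; have := eqn true; have := eqn false => /= e2 e3.
by rewrite !compA -e2 -e3.
Qed.

Lemma agree_trans c c' c'' : agree c c' -> agree c' c'' -> agree c c''.
Proof.
move=> [w [e [u [u' [uE u'E h]]]]] cc.
have [v [f [p [q [pf qf]]]]] := pair_at rK limC lexF e c''.
have [|v' [f' [n [nf eqn]]]] := equalize_at rK limC lexF (d := f) (z := fun=> plus x)
  (f := fun _ : unit => q) (g := fun=> q) (ksmall_unit rK) => //.
have h1 : forces f (fun v j => u \c (p \c j) = u' \c (p \c j)).
  by apply: (forces_pull lexF (R := fun v j => u \c j = u' \c j)); rewrite pf.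
have h2 : forces f (fun v j => u' \c p \c j = q \c j).
  by apply: agree_on cc; rewrite // fmapME pf.
exists v, f, (u \c p), q; split; rewrite ?fmapME ?pf //.
apply: forces_sub (forces_and lexF h1 h2) => v0 j [e1 e2].
by rewrite -e2 -!compA.
Qed.

End Agreement.

Lemma plus_map_defined x y (f : hom x y) c :
  defined c -> defined (fmap F (plus_map f) c).
Proof.
move=> dc; apply: forces_push; apply: forces_sub dc => v j [k <-].
by exists (f \c k); rewrite !compA plus_map_inl.
Qed.

Lemma plus_map_agree x y (f : hom x y) c c' :
  agree c c' -> agree (fmap F (plus_map f) c) (fmap F (plus_map f) c').
Proof.
move=> [w [e [u [u' [uE u'E h]]]]].
exists w, e, (plus_map f \c u), (plus_map f \c u'); split; rewrite ?fmapME ?uE ?u'E //.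
by apply: forces_sub h => v j e'; rewrite -!compA e'.
Qed.

(** The quotient by [agree] of the defined elements, as a set of equivalence
classes. *)
Definition germ x : smallT :=
  {S : set (F (plus x)) | exists2 c, defined c & S = agree c}.

Definition cls x (c : F (plus x)) (dc : defined c) : germ x :=
  exist _ (agree c) (ex_intro2 _ _ c dc erefl).

Lemma cls_eq x (c c' : F (plus x)) (dc : defined c) (dc' : defined c') :
  cls dc = cls dc' <-> agree c c'.
Proof.
split=> [[e]|cc]; first by rewrite e; exact: agree_refl.
apply: eq_exist; apply/seteqP; split=> d.
  by apply: agree_trans; exact: agree_sym.
exact: agree_trans.
Qed.

Lemma germ_cls x (xi : germ x) : exists c (dc : defined c), xi = cls dc.
Proof.
by case: xi => S [c dc e]; exists c, dc; apply: eq_exist.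
Qed.

Definition rep x (xi : germ x) : F (plus x) := sval (cid (germ_cls xi)).

Lemma rep_defined x (xi : germ x) : defined (rep xi).
Proof. by have [dc _] := svalP (cid (germ_cls xi)). Qed.

Lemma rep_cls x (xi : germ x) (dc : defined (rep xi)) : xi = cls dc.
Proof.
have [dc' {1}->] := svalP (cid (germ_cls xi)).
by apply/cls_eq; exact: agree_refl.
Qed.

Definition germ_map x y (f : hom x y) (xi : germ x) : germ y :=
  cls (plus_map_defined f (rep_defined xi)).

Lemma germ_map_cls x y (f : hom x y) c (dc : defined c)
    (dfc : defined (fmap F (plus_map f) c)) :
  germ_map f (cls dc) = cls dfc.
Proof.
apply/cls_eq/plus_map_agree/(cls_eq (rep_defined _) dc).
by rewrite -rep_cls.
Qed.

Definition localization : functor C SET.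
Proof.
refine (@Functor C SET germ germ_map _ _).
- move=> x; apply/funext => xi; have [c [dc ->]] := germ_cls xi.
  have dc' : defined (fmap F (plus_map (idm x)) c) by rewrite plus_map1 fmap1E.
  rewrite (germ_map_cls dc dc'); apply/cls_eq.
  by rewrite plus_map1 fmap1E; exact: agree_refl.
- move=> x y z g f; apply/funext => xi; have [c [dc ->]] := germ_cls xi.
  have d1 := plus_map_defined f dc; have d2 := plus_map_defined g d1.
  have d3 := plus_map_defined (g \c f) dc.
  rewrite (germ_map_cls dc d3) /= (germ_map_cls dc d1) (germ_map_cls d1 d2).
  by apply/cls_eq; rewrite plus_mapM fmapME; exact: agree_refl.
Defined.

Lemma fmap_cls x y (f : hom x y) c (dc : defined c)
    (dfc : defined (fmap F (plus_map f) c)) :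
  fmap localization f (cls dc) = cls dfc.
Proof. exact: germ_map_cls. Qed.

(** ** Limits *)

Lemma cls_eq_at x w (e : F w) (u u' : hom w (plus x))
    (du : defined (fmap F u e)) (du' : defined (fmap F u' e)) :
  cls du = cls du' <-> forces e (fun v j => u \c j = u' \c j).
Proof.
split=> [/cls_eq|h]; first exact: agree_on.
by apply/cls_eq; exists w, e, u, u'.
Qed.

(** Elements with equal images are equal on a large part, where they are given
by maps to [x] that the [f t] cannot distinguish. *)
Lemma localization_jointly_injective (T : smallT) x (y : T -> C)
    (f : forall t, hom x (y t)) (xi xi' : localization x) : ksmall K T ->
  (forall v (h h' : hom v x), (forall t, f t \c h = f t \c h') -> h = h') ->
  (forall t, fmap localization (f t) xi = fmap localization (f t) xi') -> xi = xi'.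
Proof.
move=> kT fmono; have [c [dc ->]] := germ_cls xi; have [c' [dc' ->]] := germ_cls xi'.
move=> eqf; have [w [e [u [u' [uc uc']]]]] := pair_at rK limC lexF c c'.
case: c / uc dc eqf => dc; case: c' / uc' dc' => dc' eqf.
apply/cls_eq_at.
have h t : forces e (fun v j => plus_map (f t) \c u \c j = plus_map (f t) \c u' \c j).
  have d1 := plus_map_defined (f t) dc; have d2 := plus_map_defined (f t) dc'.
  have := eqf t; rewrite (fmap_cls dc d1) (fmap_cls dc' d2) => /cls_eq.
  by apply: agree_on; rewrite fmapME.
have h1 := forces_pull lexF dc; have h2 := forces_pull lexF dc'.
have := forces_and lexF (forces_bigcap lexF kT h)
          (forces_and lexF h1 h2).
apply: forces_sub => v j [eqt [[k kE] [k' k'E]]].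
rewrite -kE -k'E; congr (_ \c _); apply: fmono => t.
apply: (@inl_mono _ rK _ limC copC (y t)).
by rewrite !compA -!(plus_map_inl rK limC copC) -!compA kE k'E !compA.
Qed.

Lemma localization_mono x y (f : hom x y) : mono f -> injective (fmap localization f).
Proof.
move=> mf xi xi' e.
apply: (@localization_jointly_injective unit x (fun=> y) (fun=> f)) => //.
  exact: ksmall_unit.
by move=> v h h' /(_ tt)/mf.
Qed.

(** A compatible family is represented by elements of the [F (X j + 1)] which,
on a large part, are all defined and strictly compatible; there they factor
through the limit, and [forces_extend] turns the factorization into an element
of [F (l + 1)]. *)
Lemma localization_limit : preserves_ksmall_limits K localization.
Proof.
move=> J X l p [T [ar [bar kT]]] lp; have [cp up] := lp.
have surj (A : {i : J & {j : J & hom i j}}) : exists t, ar t = A.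
  by have [g _ gK] := bar; exists (g A).
split=> [i j u|z q cq].
  by rewrite -(cp i j u) fmapM.
have inj (xi xi' : localization l) :
    (forall j, fmap localization (p j) xi = fmap localization (p j) xi') -> xi = xi'.
  move=> h; apply: (localization_jointly_injective
    (f := fun t => p (projT1 (ar t))) kT) => // v g g' eg.
  have [|k [_ ku]] := up v (fun j => p j \c g).
    by move=> i j u; rewrite compA cp.
  rewrite -(ku g) // -(ku g') // => j.
  have [t tE] := surj (existT _ j (existT _ j (idm j))).
  by have := eg t; rewrite tE.
suff ex (xi : forall j, localization (X j)) :
    (forall i j (u : hom i j), fmap localization (fmap X u) (xi i) = xi j) ->
    exists zeta, forall j, fmap localization (p j) zeta = xi j.
  have /choice[h hE] (t : z) : exists zeta, forall j,
      fmap localization (p j) zeta = q j t.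
    by apply: ex => i j u; exact: (congr1 (@^~ t) (cq i j u)).
  exists h; split=> [j|h' h'E]; first by apply/funext => t; exact: hE.
  apply/funext => t; apply: inj => j; rewrite hE.
  exact: (congr1 (@^~ t) (esym (h'E j))).
move=> xiE.
have [w [e [pi piE]]] := common_source rK limC lexF
  (fun t => rep (xi (projT1 (ar t)))) kT.
have pj j : exists h : hom w (plus (X j)), fmap F h e = rep (xi j).
  have [t tE] := surj (existT _ j (existT _ j (idm j))).
  by have := pi t; have := piE t; move: (pi t); rewrite tE /= => h hE _; exists h.
pose pr j := sval (cid (pj j)); have prE j : fmap F (pr j) e = rep (xi j) := svalP (cid (pj j)).
have dpr j : defined (fmap F (pr j) e) by rewrite prE; exact: rep_defined.
have xij j : xi j = cls (dpr j).
  rewrite (rep_cls (rep_defined (xi j))); apply/cls_eq; rewrite prE; exact: agree_refl.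
pose R v (g : hom v w) := forall t, through (inl _) (pr (projT1 (ar t)) \c g) /\
  plus_map (fmap X (projT2 (projT2 (ar t)))) \c pr _ \c g = pr _ \c g.
have eR : forces e R.
  apply: (forces_bigcap lexF kT) => t; apply: (forces_and lexF).
    exact: (forces_pull lexF (dpr _)).
  move: (ar t) => -[i [j u]] /=; have := xiE i j u; rewrite !xij.
  rewrite (fmap_cls (dpr i) (plus_map_defined _ (dpr i))) => /cls_eq.
  by apply: agree_on; rewrite ?fmapME.
have [||w' [e' [rho [r [rhoE re']]]]] := forces_extend imC uniC covC lexF sm epiF
  (Q := fun v g h => forall j, pr j \c g = inl (X j) \c (p j \c h)) _ _ eR.
- by move=> v v' g h k gh j; rewrite compA gh !compA.
- move=> v g Rg.
  have th j : through (inl (X j)) (pr j \c g).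
    have [t tE] := surj (existT _ j (existT _ j (idm j))).
    by have [] := Rg t; rewrite tE.
  pose h j := sval (cid (th j)); have hE j : inl (X j) \c h j = pr j \c g := svalP (cid (th j)).
  have [|k [kE _]] := up v h; last by exists k => j; rewrite kE hE.
  move=> i j u; apply: (@inl_mono _ rK _ limC copC (X j)).
  have [t tE] := surj (existT _ i (existT _ j u)).
  have [_] := Rg t; rewrite tE /= => uE.
  by rewrite compA -(plus_map_inl rK limC copC) -compA hE compA uE hE.
have dr : defined (fmap F r e').
  by apply: forces_push; apply: forces_sub re' => v g [h [-> _]]; exists h.
exists (cls dr) => j.
rewrite (fmap_cls dr (plus_map_defined (p j) dr)) xij; apply/cls_eq.
exists w', e', (plus_map (p j) \c r), (pr j \c rho); split; rewrite ?fmapME ?rhoE //.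
apply: forces_sub re' => v g [h [rg /(_ j) prg]].
by rewrite -!compA rg prg !compA plus_map_inl.
Qed.

(** ** Effective epimorphisms and unions *)

(** A subobject of [y + 1] that contains the image of [x + 1] contains [y],
because [y] is a quotient of [x], and also the second summand. *)
Lemma plus_map_effective x y (f : hom x y) :
  effective_epi f -> effective_epi (plus_map f).
Proof.
move=> /[dup] [[r [p [q [[pq _] [_ u]]]]]] /effective_extremal ef.
apply: extremal_effective => // t n mn [k nk].
have nkl : n \c (k \c inl x) = inl y \c f by rewrite compA nk plus_map_inl.
have [|h [hf _]] := u t (k \c inl x).
  by apply: mn; rewrite !compA -(compA n) nkl -!compA pq.
exists (plus_pair copC h (k \c inr x)); apply: plus_ext; rewrite comp1m -compA.
  have [h' [_ h'u]] := u _ (inl y \c f) ltac:(by rewrite -!compA pq).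
  rewrite plus_pair_inl -(h'u (inl y)) //; symmetry; apply: h'u.
  by rewrite -compA hf.
by rewrite plus_pair_inr compA nk plus_pair_inr.
Qed.

Lemma plus_map_through x y v (f : hom x y) (j : hom v (plus x)) :
  through (inl y) (plus_map f \c j) -> through (inl x) j.
Proof.
move=> [k kE].
apply: (@through_inj _ rK _ limC uniC copC _ (plus_fam rK limC x) (ksmall_bool rK) v j true).
move=> [] // v' j' k' _ e; apply: (@inl_inr _ rK _ limC uniC copC y _ (k \c j') k').
rewrite compA kE -compA e compA; congr (_ \c _); exact: plus_pair_inr.
Qed.

Lemma localization_epi : preserves_effective_epis localization.
Proof.
move=> x y f ef; apply: SET_surj_effective => xi; have [c [dc ->]] := germ_cls xi.
have [c' c'E] := SET_effective_surj c (epiF (plus_map_effective ef)).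
case: c / c'E dc => dc.
have dc' : defined c'.
  apply: forces_sub (forces_pull lexF dc) => v j; exact: plus_map_through.
by exists (cls dc'); exact: fmap_cls.
Qed.

(** Let [u] be the union of the [t i].  A defined element of [F (u + 1)] lifts
along the effective epimorphism onto [u + 1] from the coproduct of the [t i] and
[1], and [forces_inj] selects one summand: not [1], since the element is defined
in [u], hence some [t i]. *)
Section Union.
Variables (I : smallT) (x : C) (t : I -> C) (f : forall i, hom (t i) x).
Variables (u : C) (n : hom u x) (k : forall i, hom (t i) u).
Hypotheses (kI : ksmall K I) (un : is_union f n) (nk : forall i, n \c k i = f i).

Definition pieces (o : option I) : C := if o is Some i then t i else one rK limC.

Definition cover_map : hom (cop copC pieces (ksmall_option rK kI)) (plus u) :=
  copair copC _ (fun o => if o is Some i return hom (pieces o) (plus u)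
    then inl u \c k i else inr u).

Local Notation piece := (inj copC pieces (ksmall_option rK kI)).

Lemma cover_map_some i : cover_map \c piece (Some i) = inl u \c k i.
Proof. by rewrite /cover_map copairE. Qed.

Lemma cover_map_none : cover_map \c piece None = inr u.
Proof. by rewrite /cover_map copairE. Qed.

Lemma cover_map_effective : effective_epi cover_map.
Proof.
apply: extremal_effective => // v n' mn' [l lE].
have [P [p1 [p2 pb]]] := pullback_exists rK limC n' (inl u).
have mp := pullback_mono pb mn'; have [_ mn _ least] := un.
have [||r rE] := least P (n \c p2).
- by move=> z g g'; rewrite -!compA => /mn/mp.
- move=> i; have [|h [[_ h2] _]] := proj2 pb _ (l \c piece (Some i)) (k i).
    by rewrite compA lE cover_map_some.
  by exists h; rewrite -compA h2 nk.
have pr : p2 \c r = idm u by apply: mn; rewrite compA rE compm1.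
exists (plus_pair copC (p1 \c r) (l \c piece None)); apply: plus_ext.
  by rewrite -compA plus_pair_inl compA (proj1 pb) -compA pr compm1 comp1m.
by rewrite -compA plus_pair_inr compA lE cover_map_none comp1m.
Qed.

Lemma localization_cover (xi : localization u) :
  exists i (eta : localization (t i)), fmap localization (k i) eta = xi.
Proof.
have [c [dc ->]] := germ_cls xi.
have [d dE] := SET_effective_surj c (epiF cover_map_effective).
case: c / dE dc => dc; have dl := forces_pull lexF dc.
have [[i|] dj] := forces_inj uniC lexF sm d; last first.
  have [v [j [[[g gE] [h hE]] []]]] :=
    forces_noninitial lexF sm (forces_and lexF dl dj).
  have e : inl u \c g = inr u \c h by rewrite gE -hE compA cover_map_none.
  exact: (inl_inr uniC e).
exists i.
have [||w [e [p [r [pe re]]]]] := forces_extend imC uniC covC lexF sm epiF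
  (Q := fun v g h => g = piece (Some i) \c h) _ _ dj.
- by move=> v v' g h g' ->; rewrite compA.
- by move=> v g [h hE]; exists h.
case: d / pe dc {dl dj} => dc.
have dr : defined (fmap F r e).
  by apply: forces_push; apply: forces_sub re => v g [h [-> _]]; exists h.
exists (cls dr); rewrite (fmap_cls dr (plus_map_defined (k i) dr)).
apply/cls_eq; exists w, e, (plus_map (k i) \c r), (cover_map \c p).
split; rewrite ?fmapME //; apply: forces_sub re => v g [h [rg pg]].
by rewrite -!compA rg pg !compA plus_map_inl cover_map_some.
Qed.

End Union.

Lemma localization_union : preserves_ksmall_unions K localization.
Proof.
move=> I x t f u n kI un; have [mf mn thr _] := un.
have injM (X Y : SET) (g : hom X Y) : injective g -> mono g.
  by move=> ig Z p q e; apply/funext => z; apply: ig; exact: (congr1 (@^~ z) e).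
pose k i := sval (cid (thr i)); have nk i : n \c k i = f i := svalP (cid (thr i)).
split=> [i||i|Z v mv hv].
- exact/injM/localization_mono.
- exact/injM/localization_mono.
- by exists (fmap localization (k i)); rewrite -fmapM nk.
have /choice[h hE] xi : exists z, v z = fmap localization n xi.
  have [i [eta <-]] := localization_cover kI un nk xi; have [g gE] := hv i.
  exists (g eta); rewrite -fmapME nk; exact: (congr1 (@^~ eta) gE).
by exists h; apply/funext.
Qed.

Lemma localization_coherent : coherent_functor K localization.
Proof.
by split; [exact: localization_limit|exact: localization_epi|exact: localization_union].
Qed.

(** ** The comparison map *)

Lemma total_defined x (c : F x) : defined (fmap F (inl x) c).
Proof. by apply: forces_push; apply: forces_true => v j; exists j. Qed.

Definition to_localization : nat_trans F localization.
Proof.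
refine (@NatTrans C SET F localization (fun x c => cls (total_defined c)) _).
move=> x y f; apply/funext => c.
change (cls (total_defined (fmap F f c)) = fmap localization f (cls (total_defined c))).
rewrite (fmap_cls _ (plus_map_defined f (total_defined c))); apply/cls_eq.
by rewrite -!fmapME plus_map_inl fmapME; exact: agree_refl.
Defined.

(** If [a] became equal to an element of [M m], then [a] would be forced to lie in
[m], against [forces_avoid]. *)
Lemma to_localization_avoids (xi : localization x0) :
  fmap localization m xi <> to_localization y0 a.
Proof.
have [c [dc ->]] := germ_cls xi.
rewrite (fmap_cls dc (plus_map_defined m dc)) => /cls_eq ag.
have [w [e [u [q [ue qe]]]]] := pair_at rK limC lexF c a.
case: c / ue dc ag => dc ag.
have h : forces e (fun v j => plus_map m \c u \c j = inl y0 \c q \c j).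
  by apply: agree_on ag; rewrite fmapME ?qe.
have [v [j [[e1 [k kE]] []]]] :=
  forces_avoid sm qe (forces_and lexF h (forces_pull lexF dc)).
exists k; apply: (@inl_mono _ rK _ limC copC y0).
by rewrite !compA -e1 -(plus_map_inl rK limC copC) -!compA kE.
Qed.

End Model.

(** * The family of coherent functors *)

Lemma avoiding_coherent_functor (K : smallT) (C : category) (F : functor C SET)
    (x y : C) (m : hom x y) (a : F y) :
  compact_cardinal K -> coherent_category K C -> has_ksmall_disjoint_coproducts K C ->
  regular_functor K F -> mono m -> (forall b, fmap F m b <> a) ->
  exists (M : functor C SET) (alpha : nat_trans F M),
    coherent_functor K M /\ forall b, fmap M m b <> alpha y a.
Proof.
move=> cK [limC imC uniC covC] copC [lexF epiF] mm am; have [rK _] := cK.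
have [s sm] := @avoiding_exists _ rK _ limC uniC copC covC _ lexF _ _ m a mm am cK.
exists (localization lexF s), (to_localization lexF s); split.
  exact: localization_coherent sm.
by move=> b; exact: to_localization_avoids sm _.
Qed.

Unset Implicit Arguments.

Theorem theorem5p14 (K : smallT)
    (hK : [set: K] #= [set: nat] \/ strongly_compact K)
    (C : category) (hsmall : small_category C)
    (hcoh : coherent_category K C)
    (hcop : has_ksmall_disjoint_coproducts K C)
    (F : functor C SET) (hF : regular_functor K F) :
  exists (I : smallT) (M : I -> functor C SET),
    (forall i, coherent_functor K (M i)) /\
    exists alpha : nat_trans F (prod_functor M), elementary alpha.
Proof.
have cK := compact_cardinal_intro hK.
have [rK _] := cK; have [limC _ _ _] := hcoh; have [lexF _] := hF.
have [X [ob [obI _ obK]]] := hsmall.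
pose I : smallT := {x : X & {y : X & {m : hom (ob x) (ob y) &
  {a : F (ob y) | mono m /\ forall b, fmap F m b <> a}}}}.
have M_exists (i : I) : {M : functor C SET & {alpha : nat_trans F M |
    coherent_functor K M /\ forall b,
      fmap M (projT1 (projT2 (projT2 i))) b <>
      alpha (ob (projT1 (projT2 i))) (sval (projT2 (projT2 (projT2 i))))}}.
  case: i => x [y [m [a [mm am]]]] /=.
  have [M /cid h] := cid (avoiding_coherent_functor cK hcoh hcop hF mm am).
  by exists M.
have /all_tag[M /all_sig[alpha alphaP]] := M_exists.
have avoided x y (m : hom x y) (c : F y) : mono m -> (forall b, fmap F m b <> c) ->
    exists i, forall b, fmap (M i) m b <> alpha i y c.
  have [x' xE] : exists x', ob x' = x by exists (obI x).
  have [y' yE] : exists y', ob y' = y by exists (obI y).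
  case: x / xE m => m; case: y / yE m c => m c mm cm.
  exists (existT _ x' (existT _ y' (existT _ m (exist _ c (conj mm cm))))).
  by have [] := alphaP (existT _ x' (existT _ y' (existT _ m (exist _ c (conj mm cm))))).
exists I, M; split=> [i|]; first by have [] := alphaP i.
have nat_alpha x y (f : hom x y) :
    (fun c i => alpha i y (fmap F f c)) =
    (fun c i => fmap (M i) f (alpha i x c)) :> (F x -> forall i, M i y).
  apply/funext => c; apply: functional_extensionality_dep => i.
  exact: (congr1 (@^~ c) (naturality (alpha i) f)).
exists (@NatTrans C SET F (prod_functor M) (fun x c i => alpha i x c) nat_alpha).
move=> x y m mm; split; first exact: nat_alpha.
have Fm_inj := lex_mono rK limC lexF mm.
have Mm_inj i : injective (fmap (M i) m).
  by have [[lexM _ _] _] := alphaP i; exact: lex_mono lexM _ _ _ mm.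
move=> Z p q pq.
have pqE t i : alpha i y (p t) = fmap (M i) m (q t i).
  exact: (congr1 (@^~ i) (congr1 (@^~ t) pq)).
have /choice[h hE] (t : Z) : exists b, fmap F m b = p t.
  apply: contrapT => none; have am b : fmap F m b <> p t by move=> e; apply: none; exists b.
  by have [i /(_ (q t i))] := avoided _ _ _ _ mm am; apply; rewrite -pqE.
exists h; split.
  split; first by apply/funext.
  apply/funext => t; apply: functional_extensionality_dep => i; apply: Mm_inj.
  by rewrite -pqE -hE; exact/esym/(congr1 (@^~ (h t)) (naturality (alpha i) m)).
move=> h' [h'E _]; apply/funext => t; apply: Fm_inj; rewrite hE.
exact: (congr1 (@^~ t) (esym h'E)).
Qed.
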